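(* Let $D \subseteq \mathbb{C}$ be a domain (nonempty connected open set), and let $\{P_n\}_{n \ge 1}$ be a sequence of analytic functions on $D$ of the form $$P_n(x) = \alpha_1(n; x)\,(\lambda_1(x))^n + \alpha_2(n; x)\,(\lambda_2(x))^n ,$$ where $\lambda_1, \lambda_2$ are analytic on $D$ and nonzero (not identically zero), there is no $\omega \in \mathbb{C}$ with $|\omega| = 1$ such that $\lambda_1 = \omega \lambda_2$ identically on $D$, and for $i = 1, 2$ the coefficient $\alpha_i(n; x)$ has the form $$\alpha_i(n; x) = n^{d_i} p_{i, d_i}(x) + n^{d_i - 1} p_{i, d_i - 1}(x) + \cdots + n\, p_{i, 1}(x) + p_{i, 0}(x),$$ where $d_i \ge 0$ is an integer (not depending on $n$ or $x$), the functions $p_{i, j}$ ($0 \le j \le d_i$) are analytic on $D$ and do not depend on $n$, and the leading coefficient function $p_{i, d_i}$ is nonzero (not identically zero). Then $z \in D$ is a limit of zeros of the family $\{P_n\}$ if either of the following conditions holds: (i) $|\lambda_1(z)| > |\lambda_2(z)|$ and $p_{1, d_1}(z) = 0$, or $|\lambda_2(z)| > |\lambda_1(z)|$ and $p_{2, d_2}(z) = 0$; (ii) $|\lambda_1(z)| = |\lambda_2(z)| > 0$ and at least one of $p_{1, d_1}(z)$ and $p_{2, d_2}(z)$ is nonzero.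
   Context: A point $z$ is called a limit of zeros of a sequence of functions $P_1, P_2, \ldots$ if there is a sequence of points $z_n$ in the domain of the functions such that $P_n(z_n) = 0$ for all sufficiently large $n$ and $\lim_{n \to \infty} z_n = z$. *)

(* Defs.v *)
From Stdlib Require Import Reals.
From Coquelicot Require Import Coquelicot.

Open Scope C_scope.

Definition connected {T : UniformSpace} (D : T -> Prop) : Prop :=
  forall U V : T -> Prop,
    open U -> open V ->
    (forall x, D x -> U x \/ V x) ->
    (exists x, D x /\ U x) ->
    (exists x, D x /\ V x) ->
    exists x, D x /\ U x /\ V x.

Definition is_domain (D : C -> Prop) : Prop :=
  (exists x, D x) /\ open (T := C_UniformSpace) D
  /\ connected (T := C_UniformSpace) D.

(* Functions on [D] are total functions [C -> C] whose values outside [D] are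
   irrelevant. Since [D] is open in all uses below, the neighbourhood on which
   the expansion holds can be shrunk to a disc contained in [D]. *)
Definition analytic_at (f : C -> C) (x : C) : Prop :=
  exists a : nat -> C,
    locally (T := C_UniformSpace) x
      (fun y => is_pseries (K := C_AbsRing) (V := C_NormedModule)
                  a (y - x) (f y)).

Definition analytic_on (D : C -> Prop) (f : C -> C) : Prop :=
  forall x, D x -> analytic_at f x.

(* [n^d p_d(x) + ... + n p_1(x) + p_0(x)]; [sum_n] includes the index [d]. *)
Definition coeff (d : nat) (p : nat -> C -> C) (n : nat) (x : C) : C :=
  sum_n (fun j => RtoC (INR n) ^ j * p j x) d.

Definition limit_of_zeros (D : C -> Prop) (P : nat -> C -> C) (z : C) : Prop :=
  exists s : nat -> C,
    (forall n, D (s n))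
    /\ eventually (fun n => P n (s n) = 0)
    /\ filterlim s eventually (locally (T := C_UniformSpace) z).

(* Main.v *)
(* Coefficients divided out, [P_n] is compared with a fixed function near [z] by a form of
   Hurwitz' theorem: if [f] has an isolated zero at [z] and [g] is uniformly close to [f] on a
   small disc, then [g] vanishes in the disc. This only needs the minimum modulus principle,
   which follows from the local normal form [f(w) + c (x - w)^k + o] of nonconstant functions,
   so no integration theory enters.

   If [|lambda1(z)| > |lambda2(z)|], then [P_n / (n^d1 lambda1^n)] tends uniformly to the leading
   coefficient [p_(1,d1)] near [z], where it has an isolated zero.

   If [|lambda1(z)| = |lambda2(z)|], the ratio [q = lambda1 / lambda2] is not locally constant, so
   there are points [w <> z] as close to [z] as desired with [|q(w)| = 1] and both leading
   coefficients nonzero at [w]. Near such a [w] the equation [P_n = 0] can be written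
   [exp(n Y_n) = 1], where [Y_n] tends uniformly to [Log(q / q(w))], which vanishes at [w]. *)
Require Import Defs.
From Stdlib Require Import Reals Lra Lia Classical ClassicalEpsilon.
From Coquelicot Require Import Coquelicot.
Open Scope C_scope.

(** * Complex numbers and power series *)

(** In the minimum modulus argument analyticity enters only as [const_or_germ]: at each point the
    function is locally constant or has a leading term [c (x - w)^k] with [k >= 1] and [c <> 0]. The
    functions compared by Hurwitz' theorem are often quotients and logarithms, and these are never
    shown to be analytic. They inherit the dichotomy from analytic functions through identities
    [f - f(w) = (g - g(w)) u] with [u] continuous and nonzero at [w]. In the balanced case the
    detour through points [w <> z] is forced: the logarithms of the coefficients exist only where
    both leading coefficients are nonzero, and one of them may vanish at [z]. The logarithm also
    tames the growth in [n]: after division by [n] the powers of [n] contribute only [log n / n],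
    and [q(w)^n] has modulus 1, so its logarithm can be taken bounded. *)

Lemma Cmod_le_abs (x : C) : (Cmod x <= Rabs (fst x) + Rabs (snd x))%R.
Proof.
  destruct x as [a b]. replace (a, b) with (RtoC a + (0, b)) by
    (unfold Cplus; simpl; f_equal; ring).
  eapply Rle_trans. apply Cmod_triangle.
  simpl. rewrite Rplus_0_r, Rplus_0_l. rewrite Cmod_R.
  apply Rplus_le_compat_l. right. unfold Cmod; simpl.
  rewrite <- (sqrt_Rsqr_abs b). f_equal. unfold Rsqr; ring.
Qed.

Lemma abs_fst_le_Cmod (x : C) : (Rabs (fst x) <= Cmod x)%R.
Proof. eapply Rle_trans. apply Rmax_l. apply Rmax_Cmod. Qed.

Lemma abs_snd_le_Cmod (x : C) : (Rabs (snd x) <= Cmod x)%R.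
Proof. eapply Rle_trans. apply Rmax_r. apply Rmax_Cmod. Qed.

Lemma Cmod_minus_sym (x y : C) : Cmod (x - y) = Cmod (y - x).
Proof. rewrite <- Cmod_opp. f_equal. ring. Qed.

Lemma Cmod_minus_le (x y : C) : (Cmod x - Cmod y <= Cmod (x - y))%R.
Proof.
  assert (H := Cmod_triangle (x - y) y).
  replace (x - y + y) with x in H by ring. lra.
Qed.

Lemma Cinv_neq_0 (x : C) : x <> 0 -> / x <> 0.
Proof.
  intros Hx E. apply C1_nz. rewrite <- (Cinv_l x Hx), E. ring.
Qed.

(** Balls of [C_UniformSpace] are squares, being products of real balls; this converts them to
    discs. The square of half-side [r / 2] lies in the disc of radius [r]. *)
Lemma locally_Cmod (x : C) (P : C -> Prop) :
  locally (T := C_UniformSpace) x P <->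
  exists r, (0 < r)%R /\ forall y, (Cmod (y - x) < r)%R -> P y.
Proof.
  split.
  - intros [e He]. exists e. split. apply cond_pos.
    intros y Hy. apply He. split; simpl.
    + eapply Rle_lt_trans; [|apply Hy]. apply (abs_fst_le_Cmod (y - x)).
    + eapply Rle_lt_trans; [|apply Hy]. apply (abs_snd_le_Cmod (y - x)).
  - intros [r [Hr H]].
    assert (Hr2 : (0 < r / 2)%R) by lra.
    exists (mkposreal _ Hr2). intros y [H1 H2]. apply H.
    eapply Rle_lt_trans. apply Cmod_le_abs.
    change (Rabs (fst y - fst x) < r / 2)%R in H1.
    change (Rabs (snd y - snd x) < r / 2)%R in H2.
    change (Rabs (fst y - fst x) + Rabs (snd y - snd x) < r)%R. lra.
Qed.

(* [F N h] is the Taylor remainder of order [N] divided by [h ^ N], so that [F N 0] is the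
   [N]-th coefficient. In this form, stability under products needs no Cauchy product of series. *)
Definition taylor_at (f : C -> C) (w : C) : Prop :=
  exists (F : nat -> C -> C) (M K r : R), (0 < M /\ 0 < K /\ 0 < r)%R /\
    forall h, (Cmod h < r)%R ->
      f (w + h) = F 0%nat h /\
      forall N, F N h = F N 0 + h * F (S N) h /\ (Cmod (F N h) <= M * K ^ N)%R.

Fixpoint csum (u : nat -> C) (n : nat) : C :=
  match n with O => 0 | S n => csum u n + u n end.

(** A ratio of at most one half makes every tail at most twice the bound of its first term. *)
Lemma csum_geom_bound (u : nat -> C) (M x : R) (N : nat) :
  (0 <= M)%R -> (0 <= x <= / 2)%R ->
  (forall n, Cmod (u n) <= M * x ^ n)%R ->
  forall m, (Cmod (csum u (N + m) - csum u N) <= 2 * M * x ^ N)%R.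
Proof.
  intros HM Hx Hu m.
  assert (Hp : (0 <= x ^ N)%R) by (apply pow_le; lra).
  (* The factor [1 - (/2)^m] makes the bound inductive: it leaves room for the next term. *)
  enough (Cmod (csum u (N + m) - csum u N) <= 2 * M * x ^ N * (1 - (/2)^m))%R.
  { assert (0 < (/2)^m)%R by (apply pow_lt; lra).
    assert (0 <= 2 * M * x ^ N)%R by (apply Rmult_le_pos; lra). nra. }
  induction m as [|m IH].
  - rewrite Nat.add_0_r. replace (csum u N - csum u N) with (RtoC 0) by ring.
    rewrite Cmod_0. simpl. lra.
  - rewrite Nat.add_succ_r. simpl csum.
    replace (csum u (N + m) + u (N + m)%nat - csum u N)
      with (csum u (N + m) - csum u N + u (N + m)%nat) by ring.
    eapply Rle_trans. apply Cmod_triangle.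
    assert (H := Hu (N + m)%nat). rewrite pow_add in H.
    assert (x ^ m <= (/2)^m)%R by (apply pow_incr; lra).
    assert (M * (x ^ N * x ^ m) <= M * (x ^ N * (/2)^m))%R.
    { apply Rmult_le_compat_l; auto. apply Rmult_le_compat_l; auto. }
    simpl. nra.
Qed.

Lemma is_series_C_csum (u : nat -> C) (l : C) :
  is_series (K := C_AbsRing) (V := C_NormedModule) u l ->
  forall eps, (0 < eps)%R ->
    exists N, forall n, (N <= n)%nat -> (Cmod (csum u n - l) < eps)%R.
Proof.
  intros H eps He.
  assert (L : locally (T := C_UniformSpace) l (fun y => (Cmod (y - l) < eps)%R))
    by (apply locally_Cmod; exists eps; auto).
  destruct (H _ L) as [N HN].
  (* [csum u n] has [n] terms, [sum_n u n] has [n + 1]; hence the shift. *)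
  exists (S N). intros [|n] Hn. lia.
  replace (csum u (S n)) with (sum_n (G := C_AbelianMonoid) u n).
  { apply HN. lia. }
  clear. induction n as [|n IH].
  - rewrite sum_O. simpl. ring.
  - rewrite sum_Sn, IH. reflexivity.
Qed.

(** Past some index both partial sums around [u n] are within 1 of the limit, so [u n] is at most 2
    in modulus. Applied at one point of the disc of convergence, this yields geometric bounds on the
    coefficients. *)
Lemma csum_bounded_terms (u : nat -> C) (l : C) :
  is_series (K := C_AbsRing) (V := C_NormedModule) u l ->
  exists M, (0 < M)%R /\ forall n, (Cmod (u n) <= M)%R.
Proof.
  intros H. destruct (is_series_C_csum u l H 1%R Rlt_0_1) as [N HN].
  assert (B : exists M, (0 < M)%R /\ forall n, (n < N)%nat -> (Cmod (u n) <= M)%R).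
  { clear HN. induction N as [|N [M [HM IH]]].
    - exists 1%R. split. lra. intros; lia.
    - exists (M + Cmod (u N))%R. assert (X := Cmod_ge_0 (u N)). split. lra.
      intros n Hn. destruct (Nat.eq_dec n N) as [->|]. lra.
      assert (Y := IH n ltac:(lia)). lra. }
  destruct B as [M [HM HB]]. exists (M + 2)%R. split. lra.
  intros n. destruct (Nat.lt_ge_cases n N) as [Hn|Hn].
  - assert (Y := HB n Hn). lra.
  - assert (H1 := HN n Hn). assert (H2 := HN (S n) ltac:(lia)). simpl in H2.
    replace (u n) with ((csum u n + u n - l) - (csum u n - l)) by ring.
    assert (T := Cmod_triangle (csum u n + u n - l) (- (csum u n - l))).
    rewrite Cmod_opp in T. unfold Cminus at 1. lra.
Qed.

Lemma Cpow_pow_n (x : C) n : pow_n (K := C_AbsRing) x n = x ^ n.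
Proof. induction n; simpl. reflexivity. rewrite IHn. reflexivity. Qed.

(** Abel's argument: boundedness of the terms at [h = r / 2] gives [|a n| <= M K^n] with
    [K = 2 / r]. For [|h| < r / 4] the ratio [K |h|] is below one half, so the tail from index [N]
    on is at most [2 M (K |h|)^N]; division by [h^N] leaves the required bound. *)
Lemma analytic_taylor (f : C -> C) (w : C) : analytic_at f w -> taylor_at f w.
Proof.
  intros [a Ha]. apply locally_Cmod in Ha. destruct Ha as [r [Hr Ha]].
  assert (Hs : forall h, (Cmod h < r)%R ->
     is_series (K := C_AbsRing) (V := C_NormedModule)
       (fun n => h ^ n * a n) (f (w + h))).
  { intros h Hh. assert (X := Ha (w + h)).
    replace (w + h - w) with h in X by ring. specialize (X Hh).
    unfold is_pseries in X. eapply is_series_ext; [|exact X].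
    intros n. simpl. rewrite Cpow_pow_n. reflexivity. }
  assert (Hr2 : (Cmod (RtoC (r / 2)) < r)%R)
    by (rewrite Cmod_R, Rabs_pos_eq; lra).
  destruct (csum_bounded_terms _ _ (Hs _ Hr2)) as [M [HM HB]].
  set (T := fun (h : C) (N : nat) => csum (fun n => h ^ n * a n) N).
  set (K := (/ (r / 2))%R). assert (HK : (0 < K)%R) by (apply Rinv_0_lt_compat; lra).
  assert (Ha2 : forall n, (Cmod (a n) <= M * K ^ n)%R).
  { intros n. assert (X := HB n). rewrite Cmod_mult, Cmod_pow, Cmod_R in X.
    rewrite (Rabs_pos_eq (r / 2)) in X by lra.
    unfold K. rewrite pow_inv.
    assert (0 < (r / 2) ^ n)%R by (apply pow_lt; lra).
    apply (Rmult_le_reg_l ((r / 2) ^ n)); auto.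
    replace ((r / 2) ^ n * (M * / (r / 2) ^ n))%R with M by (field; lra). lra. }
  assert (Hrem : forall h N, (Cmod h < r / 4)%R ->
     (Cmod (f (w + h)%C - T h N) <= 2 * M * (K * Cmod h) ^ N)%R).
  { intros h N Hh. apply Rle_plus_epsilon. intros eps He.
    assert (Hh' : (Cmod h < r)%R) by lra.
    destruct (is_series_C_csum _ _ (Hs h Hh') eps He) as [N0 HN0].
    assert (X := HN0 (N + N0)%nat ltac:(lia)).
    assert (Y : (Cmod (T h (N + N0)%nat - T h N)
        <= 2 * M * (K * Cmod h) ^ N)%R).
    { apply csum_geom_bound. lra.
      - assert (Hc := Cmod_ge_0 h). split. apply Rmult_le_pos; lra.
        unfold K. apply (Rmult_le_reg_l (r / 2)). lra.
        replace (r / 2 * (/ (r / 2) * Cmod h))%R with (Cmod h) by (field; lra). lra.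
      - intros n. rewrite Cmod_mult, Cmod_pow, Rpow_mult_distr.
        assert (0 <= Cmod h ^ n)%R by (apply pow_le, Cmod_ge_0).
        assert (Z := Rmult_le_compat_l _ _ _ H (Ha2 n)). lra. }
    replace (f (w + h)%C - T h N) with
      ((T h (N + N0)%nat - T h N)
       + (f (w + h)%C - T h (N + N0)%nat)) by ring.
    eapply Rle_trans. apply Cmod_triangle.
    rewrite (Cmod_minus_sym (f (w + h)%C)). fold (T h (N + N0)%nat) in X. lra. }
  (* The quotient is meaningless at [h = 0], where its limit [a N] is put in by hand. *)
  exists (fun (N : nat) (h : C) => if excluded_middle_informative (h = RtoC 0) then a N
     else (f (w + h)%C - T h N) / h ^ N).
  exists (2 * M)%R, K, (r / 4)%R. split. repeat split; lra.
  intros h Hh. split.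
  - destruct excluded_middle_informative as [->|Hn]; [|unfold T; simpl; field].
    (* The tail bound at [h = 0], [N = 1] is zero, which identifies [f w] with [a 0]. *)
    assert (X := Hrem (RtoC 0) 1%nat). unfold T in X. simpl in X.
    rewrite Cmod_0 in X. rewrite !Rmult_0_r, Rmult_0_l, Rmult_0_r in X.
    assert (Y : f (w + 0)%C - (0 + 1 * a 0%nat) = 0).
    { apply Cmod_eq_0. assert (Z := Cmod_ge_0 (f (w + 0)%C - (0 + 1 * a 0%nat))).
      specialize (X ltac:(lra)). lra. }
    replace (f (w + 0)%C) with (f (w + 0)%C - (0 + 1 * a 0%nat) + a 0%nat) by ring.
    rewrite Y. ring.
  - intros N. destruct (excluded_middle_informative (RtoC 0 = 0)) as [_|E]; [|congruence].
    destruct excluded_middle_informative as [->|Hn].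
    + split. ring. assert (X := Ha2 N).
      assert (0 < M * K ^ N)%R by (apply Rmult_lt_0_compat; auto; apply pow_lt; auto). lra.
    + assert (P0 : h ^ N <> 0) by (apply Cpow_nz; auto). split.
      * unfold T. simpl. field. auto.
      * rewrite Cmod_div by auto. rewrite Cmod_pow.
        assert (0 < Cmod h ^ N)%R by (apply pow_lt, Cmod_gt_0; auto).
        apply (Rmult_le_reg_r (Cmod h ^ N)); auto.
        assert (X := Hrem h N Hh). rewrite Rpow_mult_distr in X.
        unfold Rdiv. rewrite Rmult_assoc, Rinv_l by lra. lra.
Qed.

Lemma taylor_const (c w : C) : taylor_at (fun _ => c) w.
Proof.
  exists (fun N _ => match N with O => c | S _ => 0 end), (Cmod c + 1)%R, 1%R, 1%R.
  assert (X := Cmod_ge_0 c). split. repeat split; lra.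
  intros h _. split; auto. intros [|N]; rewrite pow1; split; try ring.
  - lra.
  - rewrite Cmod_0. lra.
Qed.

Lemma taylor_bound_mono (M M' K K' : R) N :
  (0 < M <= M')%R -> (0 < K <= K')%R -> (M * K ^ N <= M' * K' ^ N)%R.
Proof.
  intros HM HK. apply Rmult_le_compat; try lra.
  - apply pow_le; lra.
  - apply pow_incr; lra.
Qed.

Lemma taylor_plus (f g : C -> C) (w : C) :
  taylor_at f w -> taylor_at g w -> taylor_at (fun x => f x + g x) w.
Proof.
  intros (F & M & K & r & (HM & HK & Hr) & HF) (G & M' & K' & r' & (HM' & HK' & Hr') & HG).
  exists (fun N h => F N h + G N h), (M + M')%R, (Rmax K K'), (Rmin r r').
  assert (X1 := Rmax_l K K'). assert (X2 := Rmax_r K K').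
  split. repeat split. lra. lra. apply Rmin_pos; auto.
  intros h Hh.
  destruct (HF h) as [F0 FN]. eapply Rlt_le_trans; [apply Hh|apply Rmin_l].
  destruct (HG h) as [G0 GN]. eapply Rlt_le_trans; [apply Hh|apply Rmin_r].
  split. now rewrite F0, G0.
  intros N. destruct (FN N) as [F1 F2], (GN N) as [G1 G2]. split.
  - rewrite F1, G1 at 1. ring.
  - eapply Rle_trans. apply Cmod_triangle.
    assert (Y1 := taylor_bound_mono M M K (Rmax K K') N ltac:(lra) ltac:(lra)).
    assert (Y2 := taylor_bound_mono M' M' K' (Rmax K K') N ltac:(lra) ltac:(lra)).
    lra.
Qed.

Lemma csum_ext (u v : nat -> C) n :
  (forall i, (i < n)%nat -> u i = v i) -> csum u n = csum v n.
Proof.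
  induction n as [|n IH]; intros H; simpl; auto.
  rewrite IH, H; auto.
Qed.

Lemma csum_plus_mult (u v : nat -> C) (h : C) n :
  csum (fun i => u i + h * v i) n = csum u n + h * csum v n.
Proof. induction n as [|n IH]; simpl. ring. rewrite IH. ring. Qed.

Lemma csum_bound (u : nat -> C) (B : R) n :
  (forall i, (i < n)%nat -> (Cmod (u i) <= B)%R) -> (Cmod (csum u n) <= INR n * B)%R.
Proof.
  induction n as [|n IH]; intros H.
  - simpl. rewrite Cmod_0. lra.
  - simpl csum. rewrite S_INR. eapply Rle_trans. apply Cmod_triangle.
    assert (Y := IH ltac:(auto)). assert (Z := H n ltac:(lia)). lra.
Qed.

Lemma INR_le_pow2 n : (INR n + 1 <= 2 ^ n)%R.
Proof.
  induction n as [|n IH]. simpl; lra.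
  rewrite S_INR. simpl. assert (0 <= INR n)%R by apply pos_INR. lra.
Qed.

(* The remainders of a product are
   [(f g)_N = f_N g + sum_(i < N) f_i(0) g_(N-i)]; their [N+1] terms cost a factor
   [2 ^ N] in the geometric bound. *)
Lemma taylor_mult (f g : C -> C) (w : C) :
  taylor_at f w -> taylor_at g w -> taylor_at (fun x => f x * g x) w.
Proof.
  intros (F & M & K & r & (HM & HK & Hr) & HF) (G & M' & K' & r' & (HM' & HK' & Hr') & HG).
  exists (fun N h => F N h * G 0%nat h + csum (fun i => F i 0 * G (N - i)%nat h) N),
    (M * M')%R, (2 * Rmax K K')%R, (Rmin r r').
  assert (X1 := Rmax_l K K'). assert (X2 := Rmax_r K K').
  split. repeat split. apply Rmult_lt_0_compat; lra. lra. apply Rmin_pos; auto.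
  intros h Hh.
  destruct (HF h) as [F0 FN]. eapply Rlt_le_trans; [apply Hh|apply Rmin_l].
  destruct (HG h) as [G0 GN]. eapply Rlt_le_trans; [apply Hh|apply Rmin_r].
  destruct (HF 0) as [_ FZ]. rewrite Cmod_0; auto.
  split. simpl. rewrite F0, G0. ring.
  intros N. split.
  - transitivity ((F N 0 + h * F (S N) h) * G 0%nat h
      + (csum (fun i => F i 0 * G (N - i)%nat 0) N
         + h * csum (fun i => F i 0 * G (S N - i)%nat h) N)).
    + rewrite <- csum_plus_mult. destruct (FN N) as [<- _]. f_equal.
      apply csum_ext. intros i Hi. rewrite Nat.sub_succ_l by lia.
      destruct (GN (N - i)%nat) as [-> _]. ring.
    + change (csum (fun i => F i 0 * G (S N - i)%nat h) (S N)) with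
        (csum (fun i => F i 0 * G (S N - i)%nat h) N + F N 0 * G (S N - N)%nat h).
      replace (S N - N)%nat with 1%nat by lia.
      destruct (GN 0%nat) as [-> _]. ring.
  - set (L := Rmax K K').
    assert (HL : (0 < L)%R) by (unfold L; lra).
    assert (E : forall i h', (i <= N)%nat -> (Cmod h' < r)%R ->
       (Cmod (F i h' * G (N - i)%nat h) <= M * M' * L ^ N)%R).
    { intros i h' Hi Hh'. rewrite Cmod_mult.
      replace N with (i + (N - i))%nat at 2 by lia. rewrite pow_add.
      destruct (HF h' Hh') as [_ FF].
      destruct (FF i) as [_ B1], (GN (N - i)%nat) as [_ B2].
      assert (Y1 := taylor_bound_mono M M K L i ltac:(lra) ltac:(unfold L; lra)).
      assert (Y2 := taylor_bound_mono M' M' K' L (N - i) ltac:(lra) ltac:(unfold L; lra)).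
      replace (M * M' * (L ^ i * L ^ (N - i)))%R
        with ((M * L ^ i) * (M' * L ^ (N - i)))%R by ring.
      apply Rmult_le_compat; try apply Cmod_ge_0; lra. }
    eapply Rle_trans. apply Cmod_triangle.
    assert (E1 : (Cmod (F N h * G 0%nat h) <= M * M' * L ^ N)%R).
    { assert (Y := E N h (le_n _)). rewrite Nat.sub_diag in Y. apply Y.
      eapply Rlt_le_trans; [apply Hh|apply Rmin_l]. }
    assert (E2 : (Cmod (csum (fun i => F i 0 * G (N - i)%nat h)%C N)
                  <= INR N * (M * M' * L ^ N))%R).
    { apply csum_bound. intros i Hi. apply E. lia. rewrite Cmod_0; auto. }
    rewrite Rpow_mult_distr. assert (Z := INR_le_pow2 N).
    assert (0 < M * M' * L ^ N)%R
      by (apply Rmult_lt_0_compat; [apply Rmult_lt_0_compat; auto|apply pow_lt; auto]).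
    assert (Z' := Rmult_le_compat_r (M * M' * L ^ N) _ _ ltac:(lra) Z). lra.
Qed.

Lemma taylor_scal (c : C) (f : C -> C) (w : C) :
  taylor_at f w -> taylor_at (fun x => c * f x) w.
Proof. intros H. apply (taylor_mult (fun _ => c)); auto. apply taylor_const. Qed.

Lemma taylor_pow (f : C -> C) (w : C) n :
  taylor_at f w -> taylor_at (fun x => f x ^ n) w.
Proof.
  intros H. induction n as [|n IH]; simpl. apply taylor_const.
  apply taylor_mult; auto.
Qed.

Lemma taylor_coeff (d : nat) (p : nat -> C -> C) n (w : C) :
  (forall j, (j <= d)%nat -> taylor_at (p j) w) -> taylor_at (coeff d p n) w.
Proof.
  unfold coeff. induction d as [|d IH]; intros H.
  - assert (X := taylor_scal (RtoC (INR n) ^ 0) (p 0%nat) w (H 0%nat (le_n _))).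
    destruct X as (F & M & K & r & HH & HF).
    exists F, M, K, r. split; auto. intros h Hh.
    rewrite sum_O. auto.
  - assert (X := taylor_plus _ _ _ (IH ltac:(intros; apply H; lia))
      (taylor_scal (RtoC (INR n) ^ (S d)) (p (S d)) w (H (S d) (le_n _)))).
    destruct X as (F & M & K & r & HH & HF).
    exists F, M, K, r. split; auto. intros h Hh.
    rewrite sum_Sn. apply HF; auto.
Qed.

(** * Local behaviour of analytic functions *)

Definition ccont (f : C -> C) (w : C) : Prop :=
  forall eps, (0 < eps)%R -> exists delta, (0 < delta)%R /\
    forall x, (Cmod (x - w) < delta)%R -> (Cmod (f x - f w) < eps)%R.

(** The expansion [f(x) = f(w) + c (x - w)^k + o(|x - w|^k)]; the inequality is not strict so that
    [x = w] is covered. *)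
Definition germ (f : C -> C) (w : C) (k : nat) (c : C) : Prop :=
  forall eps, (0 < eps)%R -> exists delta, (0 < delta)%R /\
    forall x, (Cmod (x - w) < delta)%R ->
      (Cmod (f x - f w - c * (x - w) ^ k) <= eps * Cmod (x - w) ^ k)%R.

Definition constant_near (f : C -> C) (w : C) : Prop :=
  exists delta, (0 < delta)%R /\
    forall x, (Cmod (x - w) < delta)%R -> f x = f w.

(** The exponent is [S k] so that the leading term vanishes at [w]: it is the first nonconstant term
    of the expansion. *)
Definition const_or_germ (f : C -> C) (w : C) : Prop :=
  constant_near f w \/ exists (k : nat) (c : C), c <> 0 /\ germ f w (S k) c.

(** As long as the coefficients of index 1 to [N] vanish, [f(w + h) - f(w) = h^(N+1) F (N+1) h]. The
    first nonzero coefficient therefore gives the leading term. *)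
Lemma taylor_const_or_germ (f : C -> C) (w : C) :
  taylor_at f w -> const_or_germ f w.
Proof.
  intros (F & M & K & r & (HM & HK & Hr) & HF).
  destruct (HF 0) as [Z0 ZN]. rewrite Cmod_0; auto.
  assert (E0 : f w = F 0%nat 0) by (rewrite <- Z0; f_equal; ring).
  assert (P : forall N h, (Cmod h < r)%R ->
    (forall i, (i < N)%nat -> F (S i) 0 = 0) -> f (w + h) - f w = h ^ (S N) * F (S N) h).
  { intros N h Hh. destruct (HF h Hh) as [H0 HN]. induction N as [|N IH]; intros Hi.
    - rewrite H0, E0. destruct (HN 0%nat) as [-> _]. simpl. ring.
    - rewrite IH by auto. destruct (HN (S N)) as [-> _].
      rewrite (Hi N) by lia. simpl. ring. }
  destruct (classic (exists N, F (S N) 0 <> 0)) as [HE|HE].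
  - right.
    assert (HE' : exists N, F (S N) 0 <> 0 /\ forall i, (i < N)%nat -> F (S i) 0 = 0).
    { destruct HE as [N HN]. revert HN. induction N as [N IH] using (well_founded_ind Nat.lt_wf_0).
      intros HN.
      destruct (classic (exists i, (i < N)%nat /\ F (S i) 0 <> 0)) as [(i & Hi & Hn)|Hno].
      - apply (IH i); auto.
      - exists N. split; auto. intros i Hi. apply NNPP. intros Hc. apply Hno. eauto. }
    destruct HE' as (N & HN & Hi). exists N, (F (S N) (RtoC 0)). split; auto.
    intros eps He.
    assert (HB : (0 < M * K ^ (S (S N)))%R)
      by (apply Rmult_lt_0_compat; auto; apply pow_lt; auto).
    (* The error is [h^(N+1)] times [h F (N+2) h], and [M K^(N+2)] bounds the last remainder. *)
    exists (Rmin r (eps / (M * K ^ (S (S N))))). split.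
    { apply Rmin_pos; auto. apply Rdiv_lt_0_compat; auto. }
    intros x Hx.
    assert (Hx1 : (Cmod (x - w) < r)%R) by (eapply Rlt_le_trans; [apply Hx|apply Rmin_l]).
    assert (Hx2 : (Cmod (x - w) < eps / (M * K ^ (S (S N))))%R)
      by (eapply Rlt_le_trans; [apply Hx|apply Rmin_r]).
    assert (Q := P N (x - w) Hx1 Hi). replace (w + (x - w)) with x in Q by ring.
    rewrite Q. destruct (HF _ Hx1) as [_ HN1]. destruct (HN1 (S N)) as [-> _].
    destruct (HN1 (S (S N))) as [_ B]. set (h := x - w) in *.
    replace (h ^ S N * (F (S N) 0 + h * F (S (S N)) h) - F (S N) 0 * h ^ S N)
      with (h * F (S (S N)) h * h ^ S N) by ring.
    rewrite !Cmod_mult, Cmod_pow. apply Rmult_le_compat_r. apply pow_le, Cmod_ge_0.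
    assert (Y := Rmult_le_compat_l _ _ _ (Cmod_ge_0 h) B).
    assert (Y2 := Rmult_lt_compat_r _ _ _ HB Hx2).
    replace (eps / (M * K ^ S (S N)) * (M * K ^ S (S N)))%R with eps in Y2
      by (field; split; [apply pow_nonzero; lra|lra]). lra.
  (* With all higher coefficients zero, [|f(x) - f(w)| <= M (K |h|)^(N+1)] for every [N]; the radius
     makes [K |h| <= 1/2], so the difference is zero. *)
  - left. exists (Rmin r (/ (2 * K))). split.
    { apply Rmin_pos; auto. apply Rinv_0_lt_compat; lra. }
    intros x Hx.
    assert (Hx1 : (Cmod (x - w) < r)%R) by (eapply Rlt_le_trans; [apply Hx|apply Rmin_l]).
    assert (Hx2 : (Cmod (x - w) < / (2 * K))%R)
      by (eapply Rlt_le_trans; [apply Hx|apply Rmin_r]).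
    assert (HKx : (0 <= K * Cmod (x - w) <= /2)%R).
    { assert (Y := Cmod_ge_0 (x - w)). split. apply Rmult_le_pos; lra.
      apply Rlt_le in Hx2. apply (Rmult_le_compat_l K) in Hx2; [|lra].
      replace (K * / (2 * K))%R with (/2)%R in Hx2 by (field; lra). lra. }
    assert (B : forall N, (Cmod (f x - f w) <= M * (/2) ^ (S N))%R).
    { intros N. assert (Q := P N (x - w) Hx1). replace (w + (x - w)) with x in Q by ring.
      rewrite Q. 2: { intros i _. apply NNPP. intros Hc. apply HE. eauto. }
      destruct (HF _ Hx1) as [_ HN1]. destruct (HN1 (S N)) as [_ B].
      rewrite Cmod_mult, Cmod_pow.
      assert (T := pow_incr _ _ (S N) HKx). rewrite Rpow_mult_distr in T.
      assert (T2 := Rmult_le_compat_l _ _ _ (pow_le _ (S N) (Cmod_ge_0 (x - w))) B).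
      assert (T3 := Rmult_le_compat_l M _ _ ltac:(lra) T). lra. }
    assert (Z : Cmod (f x - f w) = 0%R).
    { apply Rle_antisym; [|apply Cmod_ge_0]. apply Rnot_lt_le. intros Hp.
      destruct (pow_lt_1_zero (/2) ltac:(rewrite Rabs_pos_eq; lra) (Cmod (f x - f w) / M))
        as [N HN]. apply Rdiv_lt_0_compat; auto.
      assert (T := HN (S N) ltac:(lia)). rewrite Rabs_pos_eq in T by (apply pow_le; lra).
      apply (Rmult_lt_compat_l M) in T; auto.
      replace (M * (Cmod (f x - f w) / M))%R with (Cmod (f x - f w)) in T by (field; lra).
      assert (T2 := B N). lra. }
    apply Cmod_eq_0 in Z. replace (f x) with (f x - f w + f w) by ring. rewrite Z. ring.
Qed.

Lemma germ_ccont (f : C -> C) w k c : germ f w (S k) c -> ccont f w.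
Proof.
  intros H eps He. destruct (H 1%R Rlt_0_1) as [d [Hd Hg]].
  assert (Hc := Cmod_ge_0 c).
  exists (Rmin d (Rmin 1 (eps / (Cmod c + 2)))). split.
  { repeat apply Rmin_pos; auto. lra. apply Rdiv_lt_0_compat; lra. }
  intros x Hx.
  assert (H1 : (Cmod (x - w) < d)%R) by (eapply Rlt_le_trans; [apply Hx|apply Rmin_l]).
  assert (H2' : (Cmod (x - w) < Rmin 1 (eps / (Cmod c + 2)))%R)
    by (eapply Rlt_le_trans; [apply Hx|apply Rmin_r]).
  assert (H2 : (Cmod (x - w) < 1)%R) by (eapply Rlt_le_trans; [apply H2'|apply Rmin_l]).
  assert (H3 : (Cmod (x - w) < eps / (Cmod c + 2))%R)
    by (eapply Rlt_le_trans; [apply H2'|apply Rmin_r]).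
  assert (G := Hg x H1). set (h := x - w) in *.
  replace (f x - f w) with ((f x - f w - c * h ^ S k) + c * h ^ S k) by ring.
  eapply Rle_lt_trans. apply Cmod_triangle. rewrite Cmod_mult, Cmod_pow.
  assert (P : (Cmod h ^ S k <= Cmod h)%R).
  { simpl. assert (Cmod h ^ k <= 1)%R.
    { rewrite <- (pow1 k). apply pow_incr. assert (Y := Cmod_ge_0 h). lra. }
    assert (Y := Cmod_ge_0 h). nra. }
  apply (Rmult_lt_compat_r (Cmod c + 2)) in H3; [|lra].
  replace (eps / (Cmod c + 2) * (Cmod c + 2))%R with eps in H3 by (field; lra).
  assert (Y := Cmod_ge_0 h).
  assert (T := Rmult_le_compat_l (Cmod c) _ _ Hc P). nra.
Qed.

Lemma const_or_germ_ccont f w : const_or_germ f w -> ccont f w.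
Proof.
  intros [[d [Hd H]]|(k & c & _ & H)].
  - intros eps He. exists d. split; auto. intros x Hx. rewrite H by auto.
    replace (f w - f w) with (RtoC 0) by ring. rewrite Cmod_0. auto.
  - eapply germ_ccont; eauto.
Qed.

Lemma taylor_ccont f w : taylor_at f w -> ccont f w.
Proof. intros H. apply const_or_germ_ccont, taylor_const_or_germ, H. Qed.

(** * Minimum modulus and Hurwitz' theorem *)

(** If the infimum [m] were not attained, each point of the plane would have a disc in which
    [f >= m + d] on [K]: by lower semicontinuity at points of [K], vacuously elsewhere. Compactness
    of a square containing [K] makes [d] uniform, which contradicts the choice of [m]. *)
Lemma closed_bounded_min (K : C -> Prop) (f : C -> R) (B m0 : R) :
  (exists x, K x) ->
  (forall x, K x -> (Cmod x <= B)%R) ->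
  (forall w, ~ K w -> exists d, (0 < d)%R /\ forall x, (Cmod (x - w) < d)%R -> ~ K x) ->
  (forall w, K w -> forall eps, (0 < eps)%R -> exists d, (0 < d)%R /\
     forall x, K x -> (Cmod (x - w) < d)%R -> (f w - eps < f x)%R) ->
  (forall x, K x -> (m0 <= f x)%R) ->
  exists w, K w /\ forall x, K x -> (f w <= f x)%R.
Proof.
  intros [x0 Hx0] HB Hcl Hf Hm0.
  destruct (completeness (fun y => exists x, K x /\ y = (- f x)%R)) as [s [Hs1 Hs2]].
  { exists (- m0)%R. intros y [x [Hx ->]]. assert (X := Hm0 x Hx). lra. }
  { exists (- f x0)%R. eauto. }
  set (m := (- s)%R).
  assert (Hm : forall x, K x -> (m <= f x)%R).
  { intros x Hx. assert (X : (- f x <= s)%R) by (apply Hs1; eauto). unfold m. lra. }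
  apply NNPP. intros Hno.
  assert (Hgt : forall x, K x -> (m < f x)%R).
  { intros x Hx. destruct (Rle_lt_or_eq_dec _ _ (Hm x Hx)) as [|E]; auto.
    exfalso. apply Hno. exists x. split; auto. intros y Hy. rewrite <- E. auto. }
  (* The same [d] measures the gain in [f] and the disc, so a uniform lower bound on it is a uniform
     gain. The factor 2 lets the disc cover the square of half-side [d]. *)
  assert (Hd : forall w : C, exists d : posreal, forall x, K x ->
     (Cmod (x - w) < 2 * d)%R -> (m + d <= f x)%R).
  { intros w. destruct (classic (K w)) as [Hw|Hw].
    - assert (X := Hgt w Hw).
      destruct (Hf w Hw ((f w - m) / 2)%R ltac:(lra)) as [d [Hd H]].
      assert (P : (0 < Rmin (d / 2) ((f w - m) / 2))%R) by (apply Rmin_pos; lra).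
      exists (mkposreal _ P). simpl. intros x Hx Hxw.
      assert (Y1 := Rmin_l (d / 2) ((f w - m) / 2)).
      assert (Y2 := Rmin_r (d / 2) ((f w - m) / 2)).
      assert (Z := H x Hx ltac:(lra)). lra.
    - destruct (Hcl w Hw) as [d [Hd H]].
      assert (P : (0 < d / 2)%R) by lra.
      exists (mkposreal _ P). simpl. intros x Hx Hxw. exfalso.
      apply (H x); auto. lra. }
  set (delta := fun a b : R => proj1_sig (constructive_indefinite_description _ (Hd (a, b)))).
  assert (Hdelta : forall a b x, K x -> (Cmod (x - (a, b)) < 2 * delta a b)%R ->
     (m + delta a b <= f x)%R).
  { intros a b. unfold delta. destruct constructive_indefinite_description. auto. }
  destruct (compactness_value_2d (- B) B (- B) B delta) as [d Hdd].
  enough (forall x, K x -> (m + d <= f x)%R).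
  { assert (X : (s <= s - d)%R).
    { apply Hs2. intros y [x [Hx ->]]. assert (Y := H x Hx). unfold m in Y. lra. }
    assert (Y := cond_pos d). lra. }
  (* [compactness_value_2d] gives its point only under a double negation, hence the proof by
     contradiction. *)
  intros x Hx. apply Rnot_lt_le. intros Hlt.
  assert (X1 := HB x Hx).
  assert (X2 := abs_fst_le_Cmod x). assert (X3 := abs_snd_le_Cmod x).
  apply (Hdd (fst x) (snd x)).
  { apply Rabs_le_between. lra. }
  { apply Rabs_le_between. lra. }
  intros (u & v & _ & _ & H1 & H2 & H3).
  assert (Y : (m + delta u v <= f x)%R).
  { apply Hdelta; auto. eapply Rle_lt_trans. apply Cmod_le_abs.
    change (Rabs (fst x - u) + Rabs (snd x - v) < 2 * delta u v)%R. lra. }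
  lra.
Qed.

(** Its first use is to extract roots for the descent of the modulus; later it linearises the [n]-th
    powers. *)
Definition Cexp (z : C) : C := ((exp (fst z) * cos (snd z))%R, (exp (fst z) * sin (snd z))%R).

Lemma Cexp_plus (x y : C) : Cexp (x + y) = Cexp x * Cexp y.
Proof.
  unfold Cexp, Cmult; simpl. rewrite exp_plus, cos_plus, sin_plus.
  f_equal; ring.
Qed.

Lemma Cexp_0 : Cexp 0 = 1.
Proof. unfold Cexp; simpl. rewrite exp_0, cos_0, sin_0. unfold RtoC. f_equal; ring. Qed.

Lemma Cexp_neq_0 (x : C) : Cexp x <> 0.
Proof.
  intros H. assert (E := Cexp_plus x (- x)). rewrite H in E.
  replace (x + - x) with (RtoC 0) in E by ring. rewrite Cexp_0 in E.
  replace (0 * Cexp (- x)) with (RtoC 0) in E by ring.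
  apply RtoC_inj in E. lra.
Qed.

Lemma Cexp_opp (x : C) : Cexp (- x) = / Cexp x.
Proof.
  assert (H := Cexp_neq_0 x).
  assert (E := Cexp_plus x (- x)). replace (x + - x) with (RtoC 0) in E by ring.
  rewrite Cexp_0 in E. replace (Cexp (- x)) with (Cexp x * Cexp (- x) / Cexp x) by (field; auto).
  rewrite <- E. field. auto.
Qed.

Lemma Cexp_mult_INR n (x : C) : Cexp (RtoC (INR n) * x) = Cexp x ^ n.
Proof.
  induction n as [|n IH].
  - simpl. replace (0 * x) with (RtoC 0) by ring. apply Cexp_0.
  - rewrite S_INR, RtoC_plus. simpl. rewrite <- IH, <- Cexp_plus. f_equal. ring.
Qed.

(** Polar form, with argument [acos] of the normalised real part up to sign. The control of both
    coordinates of [y] is what later bounds the logarithm of a constant depending on [n]. *)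
Lemma Cexp_surj (v : C) : v <> 0 ->
  exists y, Cexp y = v /\ fst y = ln (Cmod v) /\ (Rabs (snd y) <= PI)%R.
Proof.
  intros Hv. assert (Hp : (0 < Cmod v)%R) by (apply Cmod_gt_0; auto).
  set (a := (fst v / Cmod v)%R). set (b := (snd v / Cmod v)%R).
  assert (Hab : (a ^ 2 + b ^ 2 = 1)%R).
  { assert (E := Cmod2_alt v). unfold Re, Im in E. unfold a, b.
    replace ((fst v / Cmod v) ^ 2 + (snd v / Cmod v) ^ 2)%R
      with ((fst v ^ 2 + snd v ^ 2) / Cmod v ^ 2)%R by (field; lra).
    rewrite <- E. field. lra. }
  assert (Ha : (-1 <= a <= 1)%R) by nra.
  assert (Hb := acos_bound a).
  assert (Hs : (sin (acos a) = Rabs b)%R).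
  { rewrite sin_acos by auto. rewrite <- sqrt_Rsqr_abs. f_equal. unfold Rsqr. nra. }
  assert (Hc := cos_acos a Ha).
  assert (T : exists t, (cos t = a /\ sin t = b /\ Rabs t <= PI)%R).
  { destruct (Rle_dec 0 b) as [Hb0|Hb0].
    - exists (acos a). rewrite Hs, Rabs_pos_eq by auto. repeat split; auto.
      rewrite Rabs_pos_eq; lra.
    - exists (- acos a)%R. rewrite cos_neg, sin_neg, Hs, Rabs_left by lra.
      repeat split; auto. lra. rewrite Rabs_Ropp, Rabs_pos_eq; lra. }
  destruct T as (t & Ht1 & Ht2 & Ht3).
  exists (ln (Cmod v), t). repeat split; auto. unfold Cexp; simpl.
  rewrite exp_ln, Ht1, Ht2 by auto. unfold a, b. destruct v as [v1 v2]; simpl fst; simpl snd.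
  f_equal; field; lra.
Qed.

Lemma Croot_exists (v : C) k : v <> 0 -> exists u, u ^ (S k) = v.
Proof.
  intros Hv. destruct (Cexp_surj v Hv) as [y [Hy _]].
  assert (HS : RtoC (INR (S k)) <> 0).
  { intros E. apply RtoC_inj in E. revert E. apply not_0_INR. lia. }
  exists (Cexp (y / RtoC (INR (S k)))). rewrite <- Cexp_mult_INR, <- Hy. f_equal.
  field. auto.
Qed.

(** The direction [u] solves [c u^(k+1) = - f(w)], so along [w + t u] the main part is
    [(1 - t^(k+1)) f(w)]. *)
Lemma germ_descent (f : C -> C) (w : C) (k : nat) (c : C) :
  c <> 0 -> germ f w (S k) c -> f w <> 0 ->
  forall d, (0 < d)%R -> exists x, (Cmod (x - w) < d)%R /\ (Cmod (f x) < Cmod (f w))%R.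
Proof.
  intros Hc Hg Hw d Hd.
  assert (Hv : - f w / c <> 0).
  { intros E. apply Hw. transitivity (- (- f w / c * c)). field; auto.
    rewrite E. ring. }
  destruct (Croot_exists _ k Hv) as [u Hu].
  assert (Hu0 : u <> 0).
  { intros ->. apply Hv. rewrite <- Hu. simpl. ring. }
  assert (Pu : (0 < Cmod u)%R) by (apply Cmod_gt_0; auto).
  assert (Pk : (0 < Cmod u ^ S k)%R) by (apply pow_lt; auto).
  assert (Pw : (0 < Cmod (f w))%R) by (apply Cmod_gt_0; auto).
  (* With this tolerance the error is at most half of the gain [t^(k+1) |f(w)|]. *)
  assert (He : (0 < Cmod (f w) / 2 / Cmod u ^ S k)%R) by (apply Rdiv_lt_0_compat; lra).
  destruct (Hg _ He) as [e [He0 HG]].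
  set (t := Rmin (/2) (Rmin d e / 2 / Cmod u)).
  assert (Pde : (0 < Rmin d e)%R) by (apply Rmin_pos; auto).
  assert (Pt : (0 < t)%R).
  { apply Rmin_pos. lra. apply Rdiv_lt_0_compat; lra. }
  assert (Ht1 : (t <= /2)%R) by apply Rmin_l.
  assert (Ht2 : (t * Cmod u < Rmin d e)%R).
  { apply Rle_lt_trans with (Rmin d e / 2 / Cmod u * Cmod u)%R.
    apply Rmult_le_compat_r. lra. apply Rmin_r.
    replace (Rmin d e / 2 / Cmod u * Cmod u)%R with (Rmin d e / 2)%R by (field; lra). lra. }
  assert (D1 := Rmin_l d e). assert (D2 := Rmin_r d e).
  exists (w + RtoC t * u).
  assert (X := HG (w + RtoC t * u)).
  replace (w + RtoC t * u - w) with (RtoC t * u) in * by ring.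
  rewrite Cmod_mult, Cmod_R, (Rabs_pos_eq t) in * by lra.
  split. lra. specialize (X ltac:(lra)).
  rewrite Cpow_mult_l, Hu, <- RtoC_pow, Rpow_mult_distr in X.
  assert (Pts : (0 < t ^ S k <= /2)%R).
  { split. apply pow_lt; auto. simpl.
    assert (t ^ k <= 1)%R by (rewrite <- (pow1 k); apply pow_incr; lra).
    assert (0 < t ^ k)%R by (apply pow_lt; auto). nra. }
  set (s := (t ^ S k)%R) in *.
  replace (Cmod (f w) / 2 / Cmod u ^ S k * (s * Cmod u ^ S k))%R
    with (s * Cmod (f w) / 2)%R in X by (field; lra).
  replace (f (w + RtoC t * u) - f w - c * (RtoC s * (- f w / c)))
    with (f (w + RtoC t * u) - (1 - RtoC s) * f w) in X by (field; auto).
  assert (Y := Cmod_minus_le (f (w + RtoC t * u)) ((1 - RtoC s) * f w)).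
  rewrite Cmod_mult in Y. replace (1 - RtoC s) with (RtoC (1 - s)) in Y, X by apply RtoC_minus.
  rewrite Cmod_R, (Rabs_pos_eq (1 - s)) in Y by lra.
  assert (Z : (0 < s * Cmod (f w))%R) by (apply Rmult_lt_0_compat; lra). lra.
Qed.

(* A nonzero minimum of [|f|] can only be attained where [f] is locally constant; the
   rightmost minimiser in the disc is not such a point. *)
Lemma zero_in_disc (f : C -> C) (z : C) (r : R) :
  (0 < r)%R ->
  (forall x, (Cmod (x - z) <= r)%R -> const_or_germ f x) ->
  (forall x, (Cmod (x - z) = r)%R -> (Cmod (f z) < Cmod (f x))%R) ->
  exists w, (Cmod (w - z) < r)%R /\ f w = 0.
Proof.
  intros Hr Hf Hb.
  assert (Zz : (Cmod (z - z) <= r)%R).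
  { replace (z - z) with (RtoC 0) by ring. rewrite Cmod_0. lra. }
  assert (BB : forall x, (Cmod (x - z) <= r)%R -> (Cmod x <= r + Cmod z)%R).
  { intros x Hx. assert (Y := Cmod_minus_le x z). lra. }
  assert (Cl : forall w, ~ (Cmod (w - z) <= r)%R -> exists d, (0 < d)%R /\
     forall x, (Cmod (x - w) < d)%R -> ~ (Cmod (x - z) <= r)%R).
  { intros w Hw. exists (Cmod (w - z) - r)%R. split. lra.
    intros x Hx Hxz. assert (Y := Cmod_minus_le (w - z) (x - z)).
    replace (w - z - (x - z)) with (w - x) in Y by ring.
    rewrite (Cmod_minus_sym w x) in Y. lra. }
  assert (Cf : forall w, (Cmod (w - z) <= r)%R -> forall eps, (0 < eps)%R ->
     exists d, (0 < d)%R /\ forall x, (Cmod (x - w) < d)%R ->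
       (Rabs (Cmod (f x) - Cmod (f w)) < eps)%R).
  { intros w Hw eps He.
    destruct (const_or_germ_ccont _ _ (Hf w Hw) eps He) as [d [Hd H]].
    exists d. split; auto. intros x Hx. specialize (H x Hx).
    assert (Y1 := Cmod_minus_le (f x) (f w)). assert (Y2 := Cmod_minus_le (f w) (f x)).
    rewrite Cmod_minus_sym in Y2. apply Rabs_def1; lra. }
  destruct (closed_bounded_min (fun x => (Cmod (x - z) <= r)%R) (fun x => Cmod (f x))
    (r + Cmod z) 0) as [w0 [Hw0 Hmin]].
  { exists z. auto. }
  { auto. }
  { auto. }
  { intros w Hw eps He. destruct (Cf w Hw eps He) as [d [Hd H]].
    exists d. split; auto. intros x _ Hx. specialize (H x Hx).
    apply Rabs_def2 in H. lra. }
  { intros. apply Cmod_ge_0. }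
  set (m := Cmod (f w0)) in *.
  (* The minimisers of [|f|] form a closed set by continuity; minimising [- fst] over it selects a
     rightmost one. *)
  destruct (closed_bounded_min
    (fun x => (Cmod (x - z) <= r)%R /\ Cmod (f x) = m) (fun x => (- fst x)%R)
    (r + Cmod z) (- (r + Cmod z))) as [w [[Hw Hwm] Hmax]].
  { exists w0. auto. }
  { intros x [Hx _]. auto. }
  { intros w Hw. destruct (classic (Cmod (w - z) <= r)%R) as [Hwz|Hwz].
    - assert (Hne : Cmod (f w) <> m) by tauto.
      assert (He : (0 < Rabs (Cmod (f w) - m))%R) by (apply Rabs_pos_lt; lra).
      destruct (Cf w Hwz _ He) as [d [Hd H]]. exists d. split; auto.
      intros x Hx [_ Hxm]. specialize (H x Hx). rewrite Hxm, Rabs_minus_sym in H. lra.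
    - destruct (Cl w Hwz) as [d [Hd H]]. exists d. split; auto.
      intros x Hx [Hx2 _]. apply (H x Hx Hx2). }
  { intros w _ eps He. exists eps. split; auto. intros x _ Hx.
    assert (Y := abs_fst_le_Cmod (x - w)).
    change (Rabs (fst x - fst w) <= Cmod (x - w))%R in Y.
    assert (Y2 : (Rabs (fst x - fst w) < eps)%R) by lra. apply Rabs_def2 in Y2. lra. }
  { intros x [Hx _]. assert (Y := abs_fst_le_Cmod x). assert (Y2 := BB x Hx).
    assert (Y3 := Rle_abs (fst x)). lra. }
  (* On the circle [|f|] exceeds [|f z|], hence exceeds the minimum. *)
  assert (Hin : (Cmod (w - z) < r)%R).
  { destruct (Rle_lt_or_eq_dec _ _ Hw) as [|E]; auto.
    assert (Y := Hb w E). assert (Y2 := Hmin z Zz). lra. }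
  exists w. split; auto. apply NNPP. intros Hne.
  assert (Near : forall x, (Cmod (x - w) < r - Cmod (w - z))%R -> (Cmod (x - z) <= r)%R).
  { intros x Hx. replace (x - z) with ((x - w) + (w - z)) by ring.
    eapply Rle_trans. apply Cmod_triangle. lra. }
  destruct (Hf w Hw) as [[d [Hd H]]|(k & c & Hc & Hg)].
  (* Where [f] is locally constant, a step [t] to the right stays among the minimisers and
     contradicts the choice of [w]. *)
  - set (t := (Rmin d (r - Cmod (w - z)) / 2)%R).
    assert (P : (0 < Rmin d (r - Cmod (w - z)))%R) by (apply Rmin_pos; lra).
    assert (P1 := Rmin_l d (r - Cmod (w - z))). assert (P2 := Rmin_r d (r - Cmod (w - z))).
    assert (E : Cmod (w + RtoC t - w) = t).
    { replace (w + RtoC t - w) with (RtoC t) by ring. rewrite Cmod_R, Rabs_pos_eq; auto.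
      unfold t; lra. }
    assert (Y := Hmax (w + RtoC t)). unfold Cplus in Y at 3. simpl in Y.
    assert (Y' : (- fst w <= - (fst w + t))%R).
    { apply Y. split. apply Near. rewrite E. unfold t; lra.
      rewrite H. auto. rewrite E. unfold t; lra. }
    unfold t in Y'. lra.
  - destruct (germ_descent f w k c Hc Hg Hne (r - Cmod (w - z)) ltac:(lra)) as [x [Hx1 Hx2]].
    assert (Y := Hmin x (Near x Hx1)). lra.
Qed.

(** With [Q = |c| r^(k+1)], the expansion gives [|f| >= Q / 2] on the circle; closeness [m = Q / 4]
    then forces [|g z| < Q / 4 < |g|] there. Both [r] and [m] are fixed before [g], so one choice
    serves all large [n]. *)
Lemma hurwitz (f : C -> C) (z : C) k (c : C) (rho : R) :
  f z = 0 -> c <> 0 -> germ f z (S k) c -> (0 < rho)%R ->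
  exists r m, (0 < r < rho)%R /\ (0 < m)%R /\
    forall g : C -> C,
      (forall x, (Cmod (x - z) <= r)%R -> const_or_germ g x) ->
      (forall x, (Cmod (x - z) <= r)%R -> (Cmod (g x - f x) < m)%R) ->
      exists w, (Cmod (w - z) < r)%R /\ g w = 0.
Proof.
  intros Hz Hc Hg Hrho.
  assert (Pc : (0 < Cmod c)%R) by (apply Cmod_gt_0; auto).
  destruct (Hg (Cmod c / 2)%R ltac:(lra)) as [d [Hd H]].
  assert (P : (0 < Rmin d rho)%R) by (apply Rmin_pos; lra).
  assert (P1 := Rmin_l d rho). assert (P2 := Rmin_r d rho).
  set (r := (Rmin d rho / 2)%R).
  assert (Hr : (0 < r)%R) by (unfold r; lra).
  assert (Prk : (0 < r ^ S k)%R) by (apply pow_lt; auto).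
  exists r, (Cmod c * r ^ S k / 4)%R. split. unfold r; lra.
  split. apply Rdiv_lt_0_compat; [apply Rmult_lt_0_compat; auto|lra].
  intros g Hgg Hm. apply zero_in_disc; auto.
  intros x Hx.
  assert (X1 := Hm x ltac:(lra)).
  assert (X2 : (Cmod (g z - f z) < Cmod c * r ^ S k / 4)%R).
  { apply Hm. replace (z - z) with (RtoC 0) by ring. rewrite Cmod_0. lra. }
  rewrite Hz in X2. replace (g z - 0) with (g z) in X2 by ring.
  assert (X3 := H x ltac:(unfold r in Hx; lra)). rewrite Hz, Hx in X3.
  replace (f x - 0 - c * (x - z) ^ S k) with (f x - c * (x - z) ^ S k) in X3 by ring.
  assert (X4 := Cmod_minus_le (c * (x - z) ^ S k) (f x)).
  rewrite Cmod_minus_sym, Cmod_mult, Cmod_pow, Hx in X4.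
  assert (X5 := Cmod_minus_le (f x) (g x)). rewrite Cmod_minus_sym in X5.
  set (q := (Cmod c * r ^ S k)%R) in *.
  replace (Cmod c / 2 * r ^ S k)%R with (q / 2)%R in X3 by (unfold q; field). lra.
Qed.

(** * Quotients and the identity theorem *)

Lemma ccont_const (c w : C) : ccont (fun _ => c) w.
Proof.
  intros eps He. exists 1%R. split. lra. intros x _.
  replace (c - c) with (RtoC 0) by ring. now rewrite Cmod_0.
Qed.

Lemma ccont_plus f g w : ccont f w -> ccont g w -> ccont (fun x => f x + g x) w.
Proof.
  intros Hf Hg eps He.
  destruct (Hf (eps / 2)%R ltac:(lra)) as [d1 [Hd1 H1]].
  destruct (Hg (eps / 2)%R ltac:(lra)) as [d2 [Hd2 H2]].
  exists (Rmin d1 d2). split. apply Rmin_pos; auto. intros x Hx.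
  assert (A1 := H1 x (Rlt_le_trans _ _ _ Hx (Rmin_l _ _))).
  assert (A2 := H2 x (Rlt_le_trans _ _ _ Hx (Rmin_r _ _))).
  replace (f x + g x - (f w + g w)) with ((f x - f w) + (g x - g w)) by ring.
  eapply Rle_lt_trans. apply Cmod_triangle. lra.
Qed.

Lemma ccont_mult f g w : ccont f w -> ccont g w -> ccont (fun x => f x * g x) w.
Proof.
  intros Hf Hg eps He.
  set (M := (Cmod (f w) + Cmod (g w) + 2)%R).
  assert (Mf := Cmod_ge_0 (f w)). assert (Mg := Cmod_ge_0 (g w)).
  assert (He2 : (0 < Rmin 1 (eps / M))%R).
  { apply Rmin_pos. lra. apply Rdiv_lt_0_compat; unfold M; lra. }
  assert (B1 := Rmin_l 1 (eps / M)). assert (B2 := Rmin_r 1 (eps / M)).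
  set (e := Rmin 1 (eps / M)) in *.
  assert (B3 : (e * M <= eps)%R).
  { apply Rle_trans with (eps / M * M)%R. apply Rmult_le_compat_r; [unfold M; lra|lra].
    right. field. unfold M; lra. }
  destruct (Hf e He2) as [d1 [Hd1 H1]]. destruct (Hg e He2) as [d2 [Hd2 H2]].
  exists (Rmin d1 d2). split. apply Rmin_pos; auto. intros x Hx.
  assert (A1 := H1 x (Rlt_le_trans _ _ _ Hx (Rmin_l _ _))).
  assert (A2 := H2 x (Rlt_le_trans _ _ _ Hx (Rmin_r _ _))).
  replace (f x * g x - f w * g w)
    with ((f x - f w) * (g x - g w) + ((f x - f w) * g w + f w * (g x - g w))) by ring.
  eapply Rle_lt_trans. eapply Rle_trans. apply Cmod_triangle.
  apply Rplus_le_compat_l. apply Cmod_triangle.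
  rewrite !Cmod_mult. assert (P1 := Cmod_ge_0 (f x - f w)). assert (P2 := Cmod_ge_0 (g x - g w)).
  unfold M in B3. nra.
Qed.

Lemma ccont_inv f w : ccont f w -> f w <> 0 -> ccont (fun x => / f x) w.
Proof.
  intros Hf Hw eps He.
  assert (P : (0 < Cmod (f w))%R) by (apply Cmod_gt_0; auto).
  set (a := Cmod (f w)) in *.
  assert (Pa : (0 < a * a)%R) by nra.
  assert (He2 : (0 < Rmin (a / 2) (eps * (a * a) / 2))%R).
  { apply Rmin_pos. lra. apply Rdiv_lt_0_compat. apply Rmult_lt_0_compat; auto. lra. }
  destruct (Hf _ He2) as [d [Hd H]]. exists d. split; auto. intros x Hx.
  assert (B1 := Rmin_l (a / 2) (eps * (a * a) / 2)).
  assert (B2 := Rmin_r (a / 2) (eps * (a * a) / 2)).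
  specialize (H x Hx).
  assert (Y := Cmod_minus_le (f w) (f x)). rewrite Cmod_minus_sym in Y. fold a in Y.
  assert (Px : (a / 2 < Cmod (f x))%R) by lra.
  assert (Nx : f x <> 0) by (apply Cmod_gt_0; lra).
  replace (/ f x - / f w) with (- (f x - f w) / (f x * f w)) by (field; auto).
  rewrite Cmod_div, Cmod_opp, Cmod_mult by (apply Cmult_neq_0; auto). fold a.
  apply (Rmult_lt_reg_r (Cmod (f x) * a)). apply Rmult_lt_0_compat; lra.
  unfold Rdiv. rewrite Rmult_assoc, Rinv_l, Rmult_1_r by (apply Rmult_integral_contrapositive; lra).
  apply Rlt_le_trans with (eps * (a * a) / 2)%R. lra.
  replace (eps * (a * a) / 2)%R with (eps * (a / 2 * a))%R by field.
  apply Rmult_le_compat_l. lra. apply Rmult_le_compat_r; lra.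
Qed.

Lemma ccont_comp f g w : ccont f w -> ccont g (f w) -> ccont (fun x => g (f x)) w.
Proof.
  intros Hf Hg eps He. destruct (Hg eps He) as [e [He' H]].
  destruct (Hf e He') as [d [Hd H']]. exists d. split; auto.
Qed.

Lemma ccont_bounded_near f w : ccont f w ->
  exists d, (0 < d)%R /\ forall x, (Cmod (x - w) < d)%R -> (Cmod (f x) <= Cmod (f w) + 1)%R.
Proof.
  intros H. destruct (H 1%R Rlt_0_1) as [d [Hd H']]. exists d. split; auto.
  intros x Hx. specialize (H' x Hx). assert (Y := Cmod_minus_le (f x) (f w)). lra.
Qed.

Lemma ccont_nonzero_near f w : ccont f w -> f w <> 0 ->
  exists d, (0 < d)%R /\ forall x, (Cmod (x - w) < d)%R -> f x <> 0.
Proof.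
  intros H Hw. assert (P : (0 < Cmod (f w))%R) by (apply Cmod_gt_0; auto).
  destruct (H _ P) as [d [Hd H']]. exists d. split; auto.
  intros x Hx E. specialize (H' x Hx). rewrite E in H'.
  replace (0 - f w) with (- f w) in H' by ring. rewrite Cmod_opp in H'. lra.
Qed.

(** With tolerance [|c| / 2], a second point of value [f w] would give [|c| <= |c| / 2]. *)
Lemma germ_isolated (f : C -> C) (w : C) k (c : C) : c <> 0 -> germ f w k c ->
  exists d, (0 < d)%R /\ forall x, (Cmod (x - w) < d)%R -> x <> w -> f x <> f w.
Proof.
  intros Hc Hg. assert (P : (0 < Cmod c)%R) by (apply Cmod_gt_0; auto).
  destruct (Hg (Cmod c / 2)%R ltac:(lra)) as [d [Hd H]]. exists d. split; auto.
  intros x Hx Hne E. specialize (H x Hx). rewrite E in H.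
  replace (f w - f w - c * (x - w) ^ k) with (- (c * (x - w) ^ k)) in H by ring.
  rewrite Cmod_opp, Cmod_mult, Cmod_pow in H.
  assert (Q : (0 < Cmod (x - w) ^ k)%R).
  { apply pow_lt, Cmod_gt_0. intros E2. apply Hne.
    replace x with (x - w + w) by ring. rewrite E2. ring. }
  nra.
Qed.

(** The transfer principle for quotients and logarithms: only continuity of [u] at the one point [w]
    enters. *)
Lemma germ_factor (f g u : C -> C) (w : C) k (c : C) :
  (exists d, (0 < d)%R /\ forall x, (Cmod (x - w) < d)%R -> f x - f w = (g x - g w) * u x) ->
  ccont u w -> germ g w k c -> germ f w k (c * u w).
Proof.
  intros [d [Hd E]] Hu Hg eps He.
  set (M := (Cmod (u w) + Cmod c + 1)%R).
  assert (M1 := Cmod_ge_0 (u w)). assert (M2 := Cmod_ge_0 c).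
  assert (HM : (0 < M)%R) by (unfold M; lra).
  set (e := Rmin 1 (eps / M)).
  assert (He2 : (0 < e)%R) by (apply Rmin_pos; [lra|apply Rdiv_lt_0_compat; lra]).
  assert (B1 : (e <= 1)%R) by apply Rmin_l.
  assert (B3 : (e * M <= eps)%R).
  { apply Rle_trans with (eps / M * M)%R. apply Rmult_le_compat_r; [lra|apply Rmin_r].
    right. field. lra. }
  destruct (Hu e He2) as [d1 [Hd1 H1]]. destruct (Hg e He2) as [d2 [Hd2 H2]].
  exists (Rmin d (Rmin d1 d2)). split. repeat apply Rmin_pos; auto. intros x Hx.
  assert (L1 := Rmin_l d (Rmin d1 d2)). assert (L2 := Rmin_r d (Rmin d1 d2)).
  assert (L3 := Rmin_l d1 d2). assert (L4 := Rmin_r d1 d2).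
  rewrite E by lra. assert (A1 := H1 x ltac:(lra)). assert (A2 := H2 x ltac:(lra)).
  replace ((g x - g w) * u x - c * u w * (x - w) ^ k) with
    ((g x - g w - c * (x - w) ^ k) * u x + c * (x - w) ^ k * (u x - u w)) by ring.
  eapply Rle_trans. apply Cmod_triangle. rewrite !Cmod_mult, Cmod_pow.
  set (q := (Cmod (x - w) ^ k)%R) in *.
  assert (Pq : (0 <= q)%R) by (apply pow_le, Cmod_ge_0).
  assert (Y := Cmod_minus_le (u x) (u w)).
  apply Rle_trans with (e * q * (Cmod (u w) + 1) + Cmod c * q * e)%R.
  - apply Rplus_le_compat.
    + apply Rmult_le_compat; try apply Cmod_ge_0; lra.
    + apply Rmult_le_compat_l. apply Rmult_le_pos; lra. lra.
  - replace (e * q * (Cmod (u w) + 1) + Cmod c * q * e)%R with (e * M * q)%R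
      by (unfold M; ring).
    apply Rmult_le_compat_r; auto.
Qed.

Lemma const_or_germ_factor (f g u : C -> C) (w : C) :
  (exists d, (0 < d)%R /\ forall x, (Cmod (x - w) < d)%R -> f x - f w = (g x - g w) * u x) ->
  ccont u w -> u w <> 0 -> const_or_germ g w -> const_or_germ f w.
Proof.
  intros HE Hu Hw [[d [Hd H]]|(k & c & Hc & Hg)].
  - left. destruct HE as [d' [Hd' E]]. exists (Rmin d d'). split. apply Rmin_pos; auto.
    intros x Hx. assert (X := E x (Rlt_le_trans _ _ _ Hx (Rmin_r _ _))).
    rewrite (H x (Rlt_le_trans _ _ _ Hx (Rmin_l _ _))) in X.
    replace (f x) with (f x - f w + f w) by ring. rewrite X. ring.
  - right. exists k, (c * u w). split. apply Cmult_neq_0; auto.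
    eapply germ_factor; eauto.
Qed.

(* [A/B - A(w)/B(w) = (A - (A(w)/B(w)) B) / B], whose numerator is analytic and vanishes at [w]. *)
Lemma quotient_const_or_germ (A B : C -> C) (w : C) :
  taylor_at A w -> taylor_at B w -> B w <> 0 -> const_or_germ (fun x => A x / B x) w.
Proof.
  intros HA HB Hw. set (q := A w / B w).
  assert (HB' := taylor_ccont _ _ HB).
  apply (const_or_germ_factor _ (fun x => A x + (- q) * B x) (fun x => / B x)).
  - destruct (ccont_nonzero_near _ _ HB' Hw) as [d [Hd H]]. exists d. split; auto.
    intros x Hx. specialize (H x Hx). unfold q. field. auto.
  - apply ccont_inv; auto.
  - apply Cinv_neq_0; auto.
  - apply taylor_const_or_germ. apply taylor_plus; auto. apply taylor_scal; auto.
Qed.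

(** The local dichotomy covers [D] by two open sets: points near which [f] vanishes, and points with
    a punctured disc free of zeros. They cannot meet, so by connectedness one of them misses [D].
    The conclusion covers [f z = 0] and [f z <> 0] alike. *)
Lemma identity_theorem (D : C -> Prop) (f : C -> C) :
  is_domain D -> (forall x, D x -> taylor_at f x) ->
  (exists x, D x /\ f x <> 0) ->
  forall z, D z -> exists d, (0 < d)%R /\
    forall x, (Cmod (x - z) < d)%R -> x <> z -> f x <> 0.
Proof.
  intros (_ & HDo & HDc) Hf [x0 [Hx0 Hfx0]] z Hz. apply NNPP. intros Hno.
  set (Z := fun x => exists d, (0 < d)%R /\ forall y, (Cmod (y - x) < d)%R -> f y = 0).
  assert (Alt : forall x, D x -> Z x \/
    exists d, (0 < d)%R /\ forall y, (Cmod (y - x) < d)%R -> y <> x -> f y <> 0).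
  { intros x Hx. destruct (classic (f x = 0)) as [E|E].
    - destruct (taylor_const_or_germ _ _ (Hf x Hx)) as [[d [Hd H]]|(k & c & Hc & Hg)].
      + left. exists d. split; auto. intros y Hy. rewrite H; auto.
      + right. destruct (germ_isolated _ _ _ _ Hc Hg) as [d [Hd H]]. exists d.
        split; auto. rewrite <- E. auto.
    - right. destruct (ccont_nonzero_near f x (taylor_ccont _ _ (Hf x Hx)) E) as [d [Hd H]].
      exists d. split; auto. }
  set (V := fun x => D x /\ exists d, (0 < d)%R /\
      forall y, (Cmod (y - x) < d)%R -> y <> x -> f y <> 0).
  assert (HZV : exists x, D x /\ Z x /\ V x).
  1: apply HDc.
  - intros x [d [Hd H]]. apply locally_Cmod. exists (d / 2)%R. split. lra.
    intros y Hy. exists (d / 2)%R. split. lra. intros t Ht. apply H.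
    replace (t - x) with ((t - y) + (y - x)) by ring.
    eapply Rle_lt_trans. apply Cmod_triangle. lra.
  - intros x [Hx [d [Hd H]]].
    destruct (proj1 (locally_Cmod x D) (HDo x Hx)) as [d' [Hd' H']].
    apply locally_Cmod. exists (Rmin d d'). split. apply Rmin_pos; auto.
    intros y Hy. assert (Dy : D y) by (apply H'; eapply Rlt_le_trans; [apply Hy|apply Rmin_r]).
    (* A neighbour [y <> x] has [f y <> 0], and continuity provides its own disc. *)
    split; auto. destruct (classic (y = x)) as [->|Hne]; eauto.
    assert (Fy : f y <> 0) by (apply H; auto; eapply Rlt_le_trans; [apply Hy|apply Rmin_l]).
    destruct (ccont_nonzero_near f y (taylor_ccont _ _ (Hf y Dy)) Fy) as [e [He HH]].
    exists e. split; auto.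
  - intros x Hx. destruct (Alt x Hx); [left; auto|right; split; auto].
  - exists z. split; auto. destruct (Alt z Hz); auto. contradiction.
  - exists x0. repeat split; auto.
    destruct (ccont_nonzero_near f x0 (taylor_ccont _ _ (Hf x0 Hx0)) Hfx0) as [e [He HH]].
    exists e. split; auto.
  - destruct HZV as (x & Hx & [d [Hd H]] & _ & [d' [Hd' H']]).
    assert (P : (0 < Rmin d d')%R) by (apply Rmin_pos; auto).
    assert (P1 := Rmin_l d d'). assert (P2 := Rmin_r d d').
    set (t := (Rmin d d' / 2)%R).
    assert (E : Cmod (x + RtoC t - x) = t).
    { replace (x + RtoC t - x) with (RtoC t) by ring. rewrite Cmod_R, Rabs_pos_eq; auto.
      unfold t; lra. }
    apply (H' (x + RtoC t)).
    + rewrite E. unfold t; lra.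
    + intros E2. rewrite E2 in E. replace (x - x) with (RtoC 0) in E by ring.
      rewrite Cmod_0 in E. unfold t in E; lra.
    + apply H. rewrite E. unfold t; lra.
Qed.

(** * Exponential and logarithm *)

Lemma derivable_pt_lim_0_bound (f : R -> R) (l : R) : derivable_pt_lim f 0 l ->
  forall eps, (0 < eps)%R -> exists d, (0 < d)%R /\
    forall h, (Rabs h < d)%R -> (Rabs (f h - f 0 - l * h) <= eps * Rabs h)%R.
Proof.
  intros H eps He. destruct (H eps He) as [d Hd]. exists d. split. apply cond_pos.
  intros h Hh. destruct (Req_dec h 0) as [->|Hn].
  - replace (f 0 - f 0 - l * 0)%R with 0%R by ring. rewrite Rabs_R0. lra.
  - specialize (Hd h Hn Hh). rewrite Rplus_0_l in Hd.
    replace (f h - f 0 - l * h)%R with (((f h - f 0) / h - l) * h)%R by (field; auto).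
    rewrite Rabs_mult. apply Rmult_le_compat_r. apply Rabs_pos. lra.
Qed.

(** The difference quotient of [Cexp] at 0 with its removable singularity filled by the derivative
    1. *)
Definition Cexp_slope (y : C) : C :=
  if excluded_middle_informative (y = RtoC 0) then RtoC 1 else (Cexp y - 1) / y.

Lemma Cexp_slope_spec y : Cexp y - 1 = y * Cexp_slope y.
Proof.
  unfold Cexp_slope. destruct excluded_middle_informative as [->|H].
  - rewrite Cexp_0. ring.
  - field. auto.
Qed.

Lemma Cexp_slope_0 : Cexp_slope 0 = 1.
Proof. unfold Cexp_slope. destruct excluded_middle_informative; congruence. Qed.

(** Complex differentiability of [Cexp] at 0, assembled from the real derivatives of [exp], [sin]
    and [cos] at 0. *)
Lemma ccont_Cexp_slope_0 : ccont Cexp_slope 0.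
Proof.
  (* The two coordinates cost [4 e] and [5 e]; 16 leaves a margin above 9. *)
  intros eps He. set (e := Rmin 1 (eps / 16)).
  assert (Pe : (0 < e)%R) by (apply Rmin_pos; lra).
  assert (e1 : (e <= 1)%R) by apply Rmin_l. assert (e2 : (e <= eps / 16)%R) by apply Rmin_r.
  destruct (derivable_pt_lim_0_bound _ _ derivable_pt_lim_exp_0 e Pe) as [da [Hda Ha]].
  destruct (derivable_pt_lim_0_bound _ _ derivable_pt_lim_sin_0 e Pe) as [ds [Hds Hs]].
  destruct (derivable_pt_lim_0_bound _ _ derivable_pt_lim_cos_0 e Pe) as [dc [Hdc Hc]].
  exists (Rmin e (Rmin da (Rmin ds dc))). split.
  { apply Rmin_pos; [exact Pe|repeat apply Rmin_pos; auto]. }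
  intros y. replace (y - 0) with y by ring. intros Hy.
  assert (L1 := Rmin_l e (Rmin da (Rmin ds dc))). assert (L2 := Rmin_r e (Rmin da (Rmin ds dc))).
  assert (L3 := Rmin_l da (Rmin ds dc)). assert (L4 := Rmin_r da (Rmin ds dc)).
  assert (L5 := Rmin_l ds dc). assert (L6 := Rmin_r ds dc).
  rewrite Cexp_slope_0. unfold Cexp_slope. destruct excluded_middle_informative as [E|Hn].
  - replace (1 - 1) with (RtoC 0) by ring. rewrite Cmod_0. auto.
  - replace ((Cexp y - 1) / y - 1) with ((Cexp y - 1 - y) / y) by (field; auto).
    rewrite Cmod_div by auto.
    assert (Py : (0 < Cmod y)%R) by (apply Cmod_gt_0; auto).
    assert (F1 := abs_fst_le_Cmod y). assert (F2 := abs_snd_le_Cmod y).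
    specialize (Ha (fst y) ltac:(lra)). specialize (Hs (snd y) ltac:(lra)).
    specialize (Hc (snd y) ltac:(lra)).
    rewrite exp_0 in Ha. rewrite sin_0 in Hs. rewrite cos_0 in Hc.
    set (a := fst y) in *. set (b := snd y) in *.
    assert (E1 : (Rabs (exp a - 1) <= 2 * e)%R).
    { replace (exp a - 1)%R with ((exp a - 1 - 1 * a) + a)%R by ring.
      eapply Rle_trans. apply Rabs_triang. assert (Q := Rabs_pos a). nra. }
    assert (E2 : (Rabs (exp a) <= 3)%R).
    { replace (exp a)%R with ((exp a - 1) + 1)%R by ring.
      eapply Rle_trans. apply Rabs_triang. rewrite Rabs_R1. lra. }
    assert (G1 : (Rabs (exp a * cos b - 1 - a) <= 4 * e * Cmod y)%R).
    { replace (exp a * cos b - 1 - a)%R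
        with ((exp a - 1 - 1 * a) + exp a * (cos b - 1 - 0 * b))%R by ring.
      eapply Rle_trans. apply Rabs_triang. rewrite Rabs_mult.
      assert (Q := Rabs_pos (exp a)). assert (Q2 := Rabs_pos (cos b - 1 - 0 * b)). nra. }
    assert (G2 : (Rabs (exp a * sin b - b) <= 5 * e * Cmod y)%R).
    { replace (exp a * sin b - b)%R
        with (exp a * (sin b - 0 - 1 * b) + (exp a - 1) * b)%R by ring.
      eapply Rle_trans. apply Rabs_triang. rewrite !Rabs_mult.
      assert (Q := Rabs_pos (exp a)). assert (Q2 := Rabs_pos (sin b - 0 - 1 * b)).
      assert (Q3 := Rabs_pos b). assert (Q4 := Rabs_pos (exp a - 1)). nra. }
    assert (G : (Cmod (Cexp y - 1 - y) <= 9 * e * Cmod y)%R).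
    { eapply Rle_trans. apply Cmod_le_abs.
      change (fst (Cexp y - 1 - y)) with (exp a * cos b + - (1) + - a)%R.
      change (snd (Cexp y - 1 - y)) with (exp a * sin b + - 0 + - b)%R.
      replace (exp a * cos b + - (1) + - a)%R with (exp a * cos b - 1 - a)%R by ring.
      replace (exp a * sin b + - 0 + - b)%R with (exp a * sin b - b)%R by ring. lra. }
    apply (Rmult_lt_reg_r (Cmod y)); auto. unfold Rdiv.
    rewrite Rmult_assoc, Rinv_l, Rmult_1_r by lra. nra.
Qed.

(* Local behaviour passes from [F = exp (s G)] to [G] since [exp y - 1 ~ y] as [y -> 0]. *)
Lemma exp_factor (G F : C -> C) (s w : C) (d0 : R) :
  s <> 0 -> ccont G w -> (0 < d0)%R ->
  (forall x, (Cmod (x - w) < d0)%R -> Cexp (s * G x) = F x) ->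
  exists u : C -> C, ccont u w /\ u w = / (s * F w) /\
    exists d, (0 < d)%R /\ forall x, (Cmod (x - w) < d)%R -> G x - G w = (F x - F w) * u x.
Proof.
  intros Hs HG Hd0 HF.
  assert (Fw : F w <> 0).
  { rewrite <- HF. apply Cexp_neq_0. replace (w - w) with (RtoC 0) by ring.
    rewrite Cmod_0; auto. }
  (* [F x - F w = F w (Cexp (s (G x - G w)) - 1) = (G x - G w) v x], so the factor sought is
     [1 / v]. *)
  set (v := fun x => s * F w * Cexp_slope (s * (G x + - G w))).
  assert (Z : s * (G w + - G w) = 0) by ring.
  assert (Hv : ccont v w).
  { apply (ccont_mult (fun _ => s * F w)). apply ccont_const.
    apply (ccont_comp (fun x => s * (G x + - G w))).
    - apply (ccont_mult (fun _ => s)). apply ccont_const.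
      apply ccont_plus; auto. apply (ccont_const (- G w)).
    - rewrite Z. apply ccont_Cexp_slope_0. }
  assert (Ev : v w = s * F w) by (unfold v; rewrite Z, Cexp_slope_0; ring).
  assert (Nv : v w <> 0) by (rewrite Ev; apply Cmult_neq_0; auto).
  exists (fun x => / v x). split. apply ccont_inv; auto. split. now rewrite Ev.
  destruct (ccont_nonzero_near _ _ Hv Nv) as [d [Hd H]].
  exists (Rmin d d0). split. apply Rmin_pos; auto. intros x Hx.
  specialize (H x (Rlt_le_trans _ _ _ Hx (Rmin_l _ _))).
  assert (E := HF x (Rlt_le_trans _ _ _ Hx (Rmin_r _ _))).
  assert (E2 : F x - F w = (G x - G w) * v x).
  { assert (X := Cexp_slope_spec (s * (G x + - G w))).
    replace (s * (G x + - G w)) with (s * G x + - (s * G w)) in X at 1 by ring.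
    rewrite Cexp_plus, Cexp_opp, E, HF in X.
    2: { replace (w - w) with (RtoC 0) by ring. rewrite Cmod_0; auto. }
    replace (F x - F w) with ((F x * / F w - 1) * F w) by (field; auto).
    rewrite X. unfold v. ring. }
  rewrite E2. field. auto.
Qed.

(** The principal logarithm on the right half-plane, where [atan] gives the argument. This is
    enough, as it is only applied within distance 1/2 of 1. *)
Definition Clog (u : C) : C := (ln (Cmod u), atan (snd u / fst u)).

Lemma Cexp_Clog (u : C) : (0 < fst u)%R -> Cexp (Clog u) = u.
Proof.
  intros Hu. assert (P : (0 < Cmod u)%R).
  { apply Rlt_le_trans with (Rabs (fst u)); [|apply abs_fst_le_Cmod].
    rewrite Rabs_pos_eq; lra. }
  unfold Cexp, Clog; simpl. rewrite exp_ln, cos_atan, sin_atan by auto.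
  assert (E : (Cmod u = fst u * sqrt (1 + (snd u / fst u)²))%R).
  { unfold Cmod. rewrite <- (sqrt_Rsqr (fst u)) at 2 by lra.
    rewrite <- sqrt_mult_alt by apply Rle_0_sqr. f_equal. unfold Rsqr. field. lra. }
  assert (S0 : (0 < sqrt (1 + (snd u / fst u)²))%R).
  { apply sqrt_lt_R0. assert (Q := Rle_0_sqr (snd u / fst u)). lra. }
  rewrite E. destruct u as [a b]; simpl fst in *; simpl snd in *.
  f_equal; field; lra.
Qed.

Lemma Clog_1 : Clog 1 = 0.
Proof.
  unfold Clog. rewrite Cmod_1, ln_1. simpl. replace (0 / 1)%R with 0%R by field.
  rewrite atan_0. reflexivity.
Qed.

(** Any absolute bound would do, since it gets divided by [n]. Here [|ln |u|| <= 1], and the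
    argument is below [PI / 2 <= 2]. *)
Lemma Clog_bound (u : C) : (Cmod (u - 1) <= / 2)%R -> (0 < fst u)%R /\ (Cmod (Clog u) <= 3)%R.
Proof.
  intros Hu. assert (X1 := Cmod_minus_le u 1). assert (X2 := Cmod_minus_le 1 u).
  rewrite Cmod_minus_sym in X2. rewrite Cmod_1 in *.
  assert (X3 := abs_fst_le_Cmod (u - 1)).
  change (Rabs (fst u - 1) <= Cmod (u - 1))%R in X3.
  assert (X4 : (Rabs (fst u - 1) <= / 2)%R) by lra.
  apply Rabs_le_between in X4. split. lra.
  eapply Rle_trans. apply Cmod_le_abs. unfold Clog; simpl fst; simpl snd.
  assert (L1 : (ln (Cmod u) <= 1)%R).
  { assert (Y := exp_ineq1_le (ln (Cmod u))). rewrite exp_ln in Y by lra. lra. }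
  assert (L2 : (-1 <= ln (Cmod u))%R).
  { assert (Y := exp_ineq1_le (- ln (Cmod u))).
    rewrite exp_Ropp, exp_ln in Y by lra.
    assert (/ Cmod u <= 2)%R.
    { rewrite <- (Rinv_inv 2). apply Rinv_le_contravar; lra. }
    lra. }
  assert (B := atan_bound (snd u / fst u)). assert (P := PI_4).
  assert (Rabs (ln (Cmod u)) <= 1)%R by (apply Rabs_le; lra).
  assert (Rabs (atan (snd u / fst u)) <= 2)%R by (apply Rabs_le; lra). lra.
Qed.

Lemma ccont_Clog (u : C) : (0 < fst u)%R -> ccont Clog u.
Proof.
  intros Hu. assert (P : (0 < Cmod u)%R).
  { apply Rlt_le_trans with (Rabs (fst u)); [|apply abs_fst_le_Cmod].
    rewrite Rabs_pos_eq; lra. }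
  assert (C1 : continuous (T := C_UniformSpace) (U := R_UniformSpace) (fun x => ln (Cmod x)) u).
  { apply (continuous_comp (U := C_UniformSpace) (V := R_UniformSpace) Cmod ln).
    - intros Q [e He]. apply locally_Cmod. exists e. split. apply cond_pos.
      intros y Hy. apply He. change (Rabs (Cmod y - Cmod u) < e)%R.
      assert (Y1 := Cmod_minus_le y u). assert (Y2 := Cmod_minus_le u y).
      rewrite Cmod_minus_sym in Y2. apply Rabs_def1; lra.
    - apply continuous_ln. auto. }
  assert (C2 : continuous (T := C_UniformSpace) (U := R_UniformSpace)
                 (fun x => atan (snd x / fst x)) u).
  { apply (continuous_comp (U := C_UniformSpace) (V := R_UniformSpace)
             (fun x => snd x / fst x)%R atan).
    - apply (continuous_mult (U := C_UniformSpace) (K := R_AbsRing)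
        (fun x => snd x) (fun x => / fst x)%R).
      + destruct u. apply continuous_snd.
      + apply (continuous_comp (U := C_UniformSpace) (V := R_UniformSpace) fst Rinv).
        destruct u. apply continuous_fst. apply continuous_Rinv. lra.
    - apply continuity_pt_filterlim. apply derivable_continuous_pt, derivable_pt_atan. }
  intros eps He.
  assert (He2 : (0 < eps / 2)%R) by lra.
  assert (K1 : locally (T := C_UniformSpace) u
    (fun x => Rabs (ln (Cmod x) - ln (Cmod u)) < eps / 2)%R).
  { apply (C1 (fun y => Rabs (y - ln (Cmod u)) < eps / 2)%R).
    exists (mkposreal _ He2). intros y Hy. exact Hy. }
  assert (K2 : locally (T := C_UniformSpace) u
    (fun x => Rabs (atan (snd x / fst x) - atan (snd u / fst u)) < eps / 2)%R).
  { apply (C2 (fun y => Rabs (y - atan (snd u / fst u)) < eps / 2)%R).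
    exists (mkposreal _ He2). intros y Hy. exact Hy. }
  apply locally_Cmod in K1. apply locally_Cmod in K2.
  destruct K1 as [d1 [Hd1 K1]]. destruct K2 as [d2 [Hd2 K2]].
  exists (Rmin d1 d2). split. apply Rmin_pos; auto. intros x Hx.
  assert (A1 := K1 x (Rlt_le_trans _ _ _ Hx (Rmin_l _ _))).
  assert (A2 := K2 x (Rlt_le_trans _ _ _ Hx (Rmin_r _ _))).
  eapply Rle_lt_trans. apply Cmod_le_abs.
  change (Rabs (ln (Cmod x) - ln (Cmod u))
    + Rabs (atan (snd x / fst x) - atan (snd u / fst u)) < eps)%R.
  simpl in A1, A2. lra.
Qed.

(** * Zeros of exponential sums *)

(** [ln n = 2 ln (sqrt n) <= 2 sqrt n], so [sqrt n > (a + 2 b) / eps] suffices. With [b = 0] it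
    serves as the Archimedean property. *)
Lemma ln_lt_linear (a b eps : R) : (0 <= a)%R -> (0 <= b)%R -> (0 < eps)%R ->
  exists N, (1 <= N)%nat /\ forall n, (N <= n)%nat -> (a + b * ln (INR n) < eps * INR n)%R.
Proof.
  intros Ha Hb He. set (q := ((a + 2 * b) / eps)%R).
  assert (Hq : (0 <= q)%R) by (apply Rdiv_le_0_compat; lra).
  destruct (INR_unbounded (q * q)) as [N0 HN0].
  exists (S N0). split. lia. intros n Hn.
  assert (Hn1 : (1 <= INR n)%R) by (apply (le_INR 1); lia).
  assert (Hn2 : (q * q < INR n)%R).
  { eapply Rlt_le_trans; [exact HN0|]. apply le_INR. lia. }
  set (s := sqrt (INR n)).
  assert (Hs : (s * s = INR n)%R) by (apply sqrt_sqrt; lra).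
  assert (Hs1 : (1 <= s)%R) by (rewrite <- sqrt_1; apply sqrt_le_1_alt; auto).
  assert (Hqs : (q < s)%R).
  { apply Rnot_le_lt. intros H. assert (s * s <= q * q)%R by (apply Rmult_le_compat; lra). lra. }
  assert (Hl : (ln (INR n) <= 2 * s)%R).
  { rewrite <- Hs, ln_mult by lra. assert (X := exp_ineq1_le (ln s)).
    rewrite exp_ln in X by lra. lra. }
  assert (E : (eps * q = a + 2 * b)%R) by (unfold q; field; lra).
  assert (X := Rmult_le_compat_l b _ _ Hb Hl).
  assert (Y : (eps * q < eps * s)%R) by (apply Rmult_lt_compat_l; auto).
  apply Rle_lt_trans with ((a + 2 * b) * s)%R. nra.
  rewrite <- E, <- Hs, <- Rmult_assoc. apply Rmult_lt_compat_r; lra.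
Qed.

(** In logarithms the claim reads [d ln n - ln eps < n (- ln kappa)]. *)
Lemma pow_INR_geom_lt (kappa eps : R) (d : nat) : (0 < kappa < 1)%R -> (0 < eps)%R ->
  exists N, forall n, (N <= n)%nat -> (INR n ^ d * kappa ^ n < eps)%R.
Proof.
  intros Hk He.
  assert (Hl : (0 < - ln kappa)%R).
  { assert (X := ln_increasing kappa 1 ltac:(lra) ltac:(lra)). rewrite ln_1 in X. lra. }
  destruct (ln_lt_linear (Rabs (ln eps)) (INR d) (- ln kappa) (Rabs_pos _) (pos_INR d) Hl)
    as [N [HN1 HN]].
  exists N. intros n Hn. specialize (HN n Hn).
  assert (Hn0 : (0 < INR n)%R) by (apply lt_0_INR; lia).
  rewrite <- (exp_ln (INR n ^ d * kappa ^ n))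
    by (apply Rmult_lt_0_compat; apply pow_lt; lra).
  rewrite <- (exp_ln eps) by auto. apply exp_increasing.
  rewrite ln_mult, !ln_pow by (try apply pow_lt; lra).
  assert (X := Rle_abs (- ln eps)). rewrite Rabs_Ropp in X. lra.
Qed.

(** The growth bound in degree [d] yields the convergence rate in degree [d + 1]: removing the top
    term leaves a sum of size [n^d], divided by [n^(d+1)]. *)
Lemma coeff_bounds (d : nat) (p : nat -> C -> C) (z : C) :
  (forall j, (j <= d)%nat -> ccont (p j) z) ->
  exists delta B, (0 < delta)%R /\ (0 < B)%R /\
    forall n x, (1 <= n)%nat -> (Cmod (x - z) < delta)%R ->
      (Cmod (coeff d p n x) <= B * INR n ^ d)%R /\
      (Cmod (coeff d p n x / RtoC (INR n ^ d) - p d x) <= B / INR n)%R.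
Proof.
  induction d as [|d IH]; intros Hp.
  - destruct (ccont_bounded_near _ _ (Hp 0%nat (le_n _))) as [e [He H]].
    assert (X := Cmod_ge_0 (p 0%nat z)).
    exists e, (Cmod (p 0%nat z) + 1)%R. split; auto. split. lra.
    intros n x Hn Hx. unfold coeff. rewrite sum_O.
    assert (Hn0 : (0 < INR n)%R) by (apply lt_0_INR; lia).
    change (RtoC (INR n) ^ 0 * p 0%nat x) with (1 * p 0%nat x).
    change (INR n ^ 0)%R with 1%R.
    replace (1 * p 0%nat x) with (p 0%nat x) by ring. split.
    + specialize (H x Hx). lra.
    + replace (p 0%nat x / 1 - p 0%nat x) with (RtoC 0) by field.
      rewrite Cmod_0. apply Rlt_le, Rdiv_lt_0_compat; lra.
  - destruct (IH ltac:(intros; apply Hp; lia)) as (e & B & He & HB & H).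
    destruct (ccont_bounded_near _ _ (Hp (S d) (le_n _))) as [e' [He' H']].
    assert (X := Cmod_ge_0 (p (S d) z)).
    exists (Rmin e e'), (B + (Cmod (p (S d) z) + 1))%R. split. apply Rmin_pos; auto. split. lra.
    intros n x Hn Hx.
    destruct (H n x Hn (Rlt_le_trans _ _ _ Hx (Rmin_l _ _))) as [H1 _].
    specialize (H' x (Rlt_le_trans _ _ _ Hx (Rmin_r _ _))).
    assert (Hn1 : (1 <= INR n)%R) by (apply (le_INR 1); lia).
    assert (Hnd : (0 < INR n ^ d)%R) by (apply pow_lt; lra).
    assert (E : coeff (S d) p n x = coeff d p n x + RtoC (INR n ^ S d) * p (S d) x).
    { unfold coeff. rewrite sum_Sn, RtoC_pow. reflexivity. }
    rewrite E.
    assert (Hnd' : (INR n ^ S d = INR n * INR n ^ d)%R) by reflexivity.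
    assert (HnS : (0 < INR n ^ S d)%R) by (apply pow_lt; lra).
    split.
    + eapply Rle_trans. apply Cmod_triangle.
      rewrite Cmod_mult, Cmod_R, (Rabs_pos_eq (INR n ^ S d)) by lra.
      assert (INR n ^ d <= INR n ^ S d)%R by (rewrite Hnd'; nra). nra.
    + assert (NZ : RtoC (INR n ^ S d) <> 0) by (intros E0; apply RtoC_inj in E0; lra).
      replace ((coeff d p n x + RtoC (INR n ^ S d) * p (S d) x) / RtoC (INR n ^ S d) - p (S d) x)
        with (coeff d p n x / RtoC (INR n ^ S d)) by (field; auto).
      rewrite Cmod_div, Cmod_R, (Rabs_pos_eq (INR n ^ S d)) by (auto; lra).
      apply Rle_trans with (B * INR n ^ d / INR n ^ S d)%R.
      * apply Rmult_le_compat_r; auto. apply Rlt_le, Rinv_0_lt_compat; auto.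
      * rewrite Hnd'. replace (B * INR n ^ d / (INR n * INR n ^ d))%R with (B / INR n)%R
          by (field; lra).
        apply Rmult_le_compat_r. apply Rlt_le, Rinv_0_lt_compat; lra. lra.
Qed.

(** The distance from the normalised [P_n] to [p1 d1] splits into [B1 / n], from the lower terms of
    the dominant coefficient, and [B2 n^d2 kappa^n], from the other exponential. Each is brought
    below [m / 2]. The roles of the two exponentials can be swapped in the application. *)
Lemma zeros_dominant (lambda1 lambda2 : C -> C) (d1 d2 : nat) (p1 p2 : nat -> C -> C)
    (z : C) (rho : R) (k : nat) (c : C) :
  (0 < rho)%R ->
  (forall x, (Cmod (x - z) < rho)%R -> taylor_at lambda1 x /\ taylor_at lambda2 x) ->
  (forall x j, (Cmod (x - z) < rho)%R -> (j <= d1)%nat -> taylor_at (p1 j) x) ->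
  (forall x j, (Cmod (x - z) < rho)%R -> (j <= d2)%nat -> taylor_at (p2 j) x) ->
  (Cmod (lambda2 z) < Cmod (lambda1 z))%R ->
  p1 d1 z = 0 -> c <> 0 -> germ (p1 d1) z (S k) c ->
  exists N, forall n, (N <= n)%nat -> exists w, (Cmod (w - z) < rho)%R /\
    coeff d1 p1 n w * lambda1 w ^ n + coeff d2 p2 n w * lambda2 w ^ n = 0.
Proof.
  intros Hrho Hl Hp1 Hp2 Hdom Hz Hc Hg.
  assert (Zz : (Cmod (z - z) < rho)%R).
  { replace (z - z) with (RtoC 0) by ring. rewrite Cmod_0. auto. }
  (* A quarter of the gap on each side leaves [b1 - b2] equal to half the gap, so [kappa < 1]. *)
  set (eta := ((Cmod (lambda1 z) - Cmod (lambda2 z)) / 4)%R).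
  assert (Heta : (0 < eta)%R) by (unfold eta; lra).
  assert (M2 := Cmod_ge_0 (lambda2 z)).
  destruct (taylor_ccont _ _ (proj1 (Hl z Zz)) eta Heta) as [e1 [He1 H1]].
  destruct (taylor_ccont _ _ (proj2 (Hl z Zz)) eta Heta) as [e2 [He2 H2]].
  destruct (coeff_bounds d1 p1 z) as (e3 & B1 & He3 & HB1 & H3).
  { intros j Hj. apply taylor_ccont. auto. }
  destruct (coeff_bounds d2 p2 z) as (e4 & B2 & He4 & HB2 & H4).
  { intros j Hj. apply taylor_ccont. auto. }
  set (delta := Rmin (Rmin rho e1) (Rmin e2 (Rmin e3 e4))).
  assert (Hdelta : (0 < delta)%R) by (repeat apply Rmin_pos; auto).
  assert (D1 : (delta <= rho)%R) by (eapply Rle_trans; [apply Rmin_l|apply Rmin_l]).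
  assert (D2 : (delta <= e1)%R) by (eapply Rle_trans; [apply Rmin_l|apply Rmin_r]).
  assert (D3 : (delta <= e2)%R) by (eapply Rle_trans; [apply Rmin_r|apply Rmin_l]).
  assert (D4 : (delta <= Rmin e3 e4)%R) by (eapply Rle_trans; [apply Rmin_r|apply Rmin_r]).
  assert (D5 := Rmin_l e3 e4). assert (D6 := Rmin_r e3 e4).
  destruct (hurwitz _ _ _ _ delta Hz Hc Hg Hdelta) as (r & m & Hr & Hm & HH).
  set (b2 := (Cmod (lambda2 z) + eta)%R). set (b1 := (Cmod (lambda1 z) - eta)%R).
  assert (Hb : (0 < b2 < b1)%R) by (unfold b1, b2, eta in *; lra).
  set (kappa := (b2 / b1)%R).
  assert (Hk : (0 < kappa < 1)%R).
  { unfold kappa. split. apply Rdiv_lt_0_compat; lra.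
    apply (Rmult_lt_reg_r b1). lra. unfold Rdiv. rewrite Rmult_assoc, Rinv_l by lra. lra. }
  destruct (pow_INR_geom_lt kappa (m / 2 / B2) d2 Hk) as [N1 HN1].
  { apply Rdiv_lt_0_compat; lra. }
  destruct (ln_lt_linear B1 0 (m / 2) ltac:(lra) ltac:(lra) ltac:(lra)) as [N2 [HN2 HN2']].
  exists (N1 + N2)%nat. intros n Hn.
  specialize (HN1 n ltac:(lia)). specialize (HN2' n ltac:(lia)).
  assert (Hn1 : (1 <= INR n)%R) by (apply (le_INR 1); lia).
  assert (Hnd : (1 <= INR n ^ d1)%R).
  { rewrite <- (pow1 d1). apply pow_incr. lra. }
  assert (NZn : RtoC (INR n ^ d1) <> 0) by (intros E0; apply RtoC_inj in E0; lra).
  assert (NZl : forall x, (Cmod (x - z) < delta)%R ->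
    (b1 < Cmod (lambda1 x))%R /\ lambda1 x ^ n <> 0).
  { intros x Hx. specialize (H1 x ltac:(lra)).
    assert (Y := Cmod_minus_le (lambda1 z) (lambda1 x)). rewrite Cmod_minus_sym in Y.
    assert (Y1 : (b1 < Cmod (lambda1 x))%R) by (unfold b1; lra).
    split; auto. apply Cpow_nz, Cmod_gt_0. lra. }
  destruct (HH (fun x => (coeff d1 p1 n x * lambda1 x ^ n + coeff d2 p2 n x * lambda2 x ^ n)
      / (RtoC (INR n ^ d1) * lambda1 x ^ n))) as [w [Hw Ew]].
  - intros x Hx. destruct (Hl x ltac:(lra)) as [T1 T2].
    apply quotient_const_or_germ.
    + apply taylor_plus; apply taylor_mult; try apply taylor_pow; auto; apply taylor_coeff;
        intros; [apply Hp1|apply Hp2]; auto; lra.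
    + apply taylor_scal, taylor_pow; auto.
    + apply Cmult_neq_0; auto. apply NZl. lra.
  - intros x Hx. destruct (NZl x ltac:(lra)) as [Y1 Y2].
    destruct (H3 n x ltac:(lia) ltac:(lra)) as [_ X1].
    destruct (H4 n x ltac:(lia) ltac:(lra)) as [X2 _].
    assert (L2 : (Cmod (lambda2 x) <= b2)%R).
    { specialize (H2 x ltac:(lra)). assert (Y := Cmod_minus_le (lambda2 x) (lambda2 z)).
      unfold b2; lra. }
    replace ((coeff d1 p1 n x * lambda1 x ^ n + coeff d2 p2 n x * lambda2 x ^ n)
      / (RtoC (INR n ^ d1) * lambda1 x ^ n) - p1 d1 x)
      with ((coeff d1 p1 n x / RtoC (INR n ^ d1) - p1 d1 x)
        + coeff d2 p2 n x * (lambda2 x ^ n / lambda1 x ^ n) / RtoC (INR n ^ d1)) by (field; auto).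
    eapply Rle_lt_trans. apply Cmod_triangle.
    assert (Q1 : (B1 / INR n < m / 2)%R).
    { apply (Rmult_lt_reg_r (INR n)). lra. unfold Rdiv at 1.
      rewrite Rmult_assoc, Rinv_l by lra. lra. }
    assert (Q2 : (Cmod (lambda2 x ^ n / lambda1 x ^ n) <= kappa ^ n)%R).
    { rewrite Cmod_div, !Cmod_pow by auto. unfold Rdiv. rewrite <- pow_inv, <- Rpow_mult_distr.
      apply pow_incr. split.
      - apply Rmult_le_pos. apply Cmod_ge_0. apply Rlt_le, Rinv_0_lt_compat; lra.
      - unfold kappa, Rdiv. apply Rmult_le_compat; auto. apply Cmod_ge_0.
        apply Rlt_le, Rinv_0_lt_compat; lra. apply Rinv_le_contravar; lra. }
    assert (Q3 : (Cmod (coeff d2 p2 n x * (lambda2 x ^ n / lambda1 x ^ n) / RtoC (INR n ^ d1))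
       < m / 2)%R).
    { rewrite Cmod_div, Cmod_mult, Cmod_R, (Rabs_pos_eq (INR n ^ d1)) by (auto; lra).
      apply Rle_lt_trans with (B2 * INR n ^ d2 * kappa ^ n)%R.
      - apply Rle_trans with (Cmod (coeff d2 p2 n x) * Cmod (lambda2 x ^ n / lambda1 x ^ n) * 1)%R.
        + apply Rmult_le_compat_l. apply Rmult_le_pos; apply Cmod_ge_0.
          rewrite <- Rinv_1. apply Rinv_le_contravar; lra.
        + rewrite Rmult_1_r. apply Rmult_le_compat; auto; apply Cmod_ge_0.
      - apply (Rmult_lt_compat_l B2) in HN1; auto.
        replace (B2 * (m / 2 / B2))%R with (m / 2)%R in HN1 by (field; lra). lra. }
    lra.
  - exists w. split. lra. destruct (NZl w ltac:(lra)) as [_ Y2].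
    assert (ND : RtoC (INR n ^ d1) * lambda1 w ^ n <> 0) by (apply Cmult_neq_0; auto).
    match type of Ew with ?A / ?B = _ => replace A with (A / B * B) by (field; auto) end.
    rewrite Ew. ring.
Qed.

Lemma ratio_close (f : C -> C) (z : C) : ccont f z -> f z <> 0 ->
  forall eps, (0 < eps)%R ->
  exists e, (0 < e)%R /\ forall x, (Cmod (x - z) < e)%R -> (Cmod (f x / f z - 1) < eps)%R.
Proof.
  intros Hf Hfz eps He.
  assert (P : (0 < Cmod (f z))%R) by (apply Cmod_gt_0; auto).
  destruct (Hf (eps * Cmod (f z))%R ltac:(apply Rmult_lt_0_compat; lra)) as [e [He' H]].
  exists e. split; auto. intros x Hx. specialize (H x Hx).
  replace (f x / f z - 1) with ((f x - f z) / f z) by (field; auto).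
  rewrite Cmod_div by auto. apply (Rmult_lt_reg_r (Cmod (f z))); auto.
  unfold Rdiv. rewrite Rmult_assoc, Rinv_l by lra. lra.
Qed.

(** Normalised by its leading term at [z], the coefficient stays where [Clog] is defined and
    bounded. The distance 1/2 splits into 1/4 for the lower terms and 1/4 for the variation of
    [p d]. *)
Lemma coeff_ratio_close (d : nat) (p : nat -> C -> C) (z : C) :
  (forall j, (j <= d)%nat -> ccont (p j) z) -> p d z <> 0 ->
  exists delta N, (0 < delta)%R /\ forall n x, (N <= n)%nat -> (Cmod (x - z) < delta)%R ->
    (Cmod (coeff d p n x / (RtoC (INR n ^ d) * p d z) - 1) <= /2)%R.
Proof.
  intros Hp Hz. assert (P : (0 < Cmod (p d z))%R) by (apply Cmod_gt_0; auto).
  destruct (ratio_close (p d) z (Hp d (le_n _)) Hz (/4)%R ltac:(lra)) as [e1 [He1 H1]].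
  destruct (coeff_bounds d p z Hp) as (e2 & B & He2 & HB & H2).
  destruct (ln_lt_linear B 0 (/4 * Cmod (p d z))) as [N [HN HN']]; try lra.
  exists (Rmin e1 e2), N. split. apply Rmin_pos; auto. intros n x Hn Hx.
  specialize (HN' n Hn).
  assert (Hn1 : (1 <= INR n)%R) by (apply (le_INR 1); lia).
  assert (NZn : RtoC (INR n ^ d) <> 0).
  { intros E0. apply RtoC_inj in E0. revert E0. apply pow_nonzero. lra. }
  destruct (H2 n x ltac:(lia) (Rlt_le_trans _ _ _ Hx (Rmin_r _ _))) as [_ X].
  assert (Y := H1 x (Rlt_le_trans _ _ _ Hx (Rmin_l _ _))).
  replace (coeff d p n x / (RtoC (INR n ^ d) * p d z) - 1)
    with ((coeff d p n x / RtoC (INR n ^ d) - p d x) / p d z + (p d x / p d z - 1))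
    by (field; auto).
  eapply Rle_trans. apply Cmod_triangle. rewrite Cmod_div by auto.
  enough (Cmod (coeff d p n x / RtoC (INR n ^ d) - p d x) / Cmod (p d z) <= /4)%R by lra.
  apply (Rmult_le_reg_r (Cmod (p d z))); auto. unfold Rdiv at 1.
  rewrite Rmult_assoc, Rinv_l, Rmult_1_r by lra.
  eapply Rle_trans. exact X. apply (Rmult_le_reg_r (INR n)). lra.
  unfold Rdiv. rewrite (Rmult_assoc B), Rinv_l by lra. lra.
Qed.

(* Here [P_n(x) = 0] says [F(x) = 1] for
   [F = - coeff_1 lambda1^n / (coeff_2 lambda2^n)]. Writing [F = exp (n Y)] with
   [Y = Log (q / q(z)) + O(log n / n)] and [q = lambda1 / lambda2] reduces this to finding a
   zero of [Y]. *)
Lemma zeros_balanced (lambda1 lambda2 : C -> C) (d1 d2 : nat) (p1 p2 : nat -> C -> C)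
    (z : C) (rho : R) (k : nat) (c : C) :
  (0 < rho)%R ->
  (forall x, (Cmod (x - z) < rho)%R -> taylor_at lambda1 x /\ taylor_at lambda2 x) ->
  (forall x j, (Cmod (x - z) < rho)%R -> (j <= d1)%nat -> taylor_at (p1 j) x) ->
  (forall x j, (Cmod (x - z) < rho)%R -> (j <= d2)%nat -> taylor_at (p2 j) x) ->
  Cmod (lambda1 z) = Cmod (lambda2 z) -> lambda2 z <> 0 ->
  p1 d1 z <> 0 -> p2 d2 z <> 0 ->
  c <> 0 -> germ (fun x => lambda1 x / lambda2 x) z (S k) c ->
  exists N, forall n, (N <= n)%nat -> exists w, (Cmod (w - z) < rho)%R /\
    coeff d1 p1 n w * lambda1 w ^ n + coeff d2 p2 n w * lambda2 w ^ n = 0.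
Proof.
  intros Hrho Hl Hp1 Hp2 Hbal Hl2 Hz1 Hz2 Hc Hg.
  assert (Zz : (Cmod (z - z) < rho)%R).
  { replace (z - z) with (RtoC 0) by ring. rewrite Cmod_0. auto. }
  assert (Hl1 : lambda1 z <> 0).
  { apply Cmod_gt_0. rewrite Hbal. apply Cmod_gt_0; auto. }
  set (q := fun x => lambda1 x / lambda2 x).
  assert (Hq : q z <> 0).
  { unfold q. intros E. apply Hl1. replace (lambda1 z) with (lambda1 z / lambda2 z * lambda2 z)
      by (field; auto). rewrite E. ring. }
  assert (Hqm : Cmod (q z) = 1%R).
  { unfold q. rewrite Cmod_div, Hbal by auto. field.
    apply Rgt_not_eq, Cmod_gt_0; auto. }
  assert (Cp1 : forall j, (j <= d1)%nat -> ccont (p1 j) z).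
  { intros j Hj. apply taylor_ccont. auto. }
  assert (Cp2 : forall j, (j <= d2)%nat -> ccont (p2 j) z).
  { intros j Hj. apply taylor_ccont. auto. }
  destruct (ratio_close q z (germ_ccont _ _ _ _ Hg) Hq (/2)%R ltac:(lra)) as [e1 [He1 H1]].
  destruct (coeff_ratio_close d1 p1 z Cp1 Hz1) as (e2 & N1 & He2 & H2).
  destruct (coeff_ratio_close d2 p2 z Cp2 Hz2) as (e3 & N2 & He3 & H3).
  destruct (ccont_nonzero_near lambda2 z (taylor_ccont _ _ (proj2 (Hl z Zz))) Hl2)
    as [e4 [He4 H4]].
  assert (Hdelta : exists delta, (0 < delta /\ delta <= rho /\ delta <= e1 /\ delta <= e2 /\
     delta <= e3 /\ delta <= e4)%R).
  { exists (Rmin rho (Rmin e1 (Rmin e2 (Rmin e3 e4)))).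
    assert (T1 := Rmin_l rho (Rmin e1 (Rmin e2 (Rmin e3 e4)))).
    assert (T2 := Rmin_r rho (Rmin e1 (Rmin e2 (Rmin e3 e4)))).
    assert (T3 := Rmin_l e1 (Rmin e2 (Rmin e3 e4))).
    assert (T4 := Rmin_r e1 (Rmin e2 (Rmin e3 e4))).
    assert (T5 := Rmin_l e2 (Rmin e3 e4)). assert (T6 := Rmin_r e2 (Rmin e3 e4)).
    assert (T7 := Rmin_l e3 e4). assert (T8 := Rmin_r e3 e4).
    split. repeat apply Rmin_pos; auto. repeat split; lra. }
  destruct Hdelta as (delta & Hdelta & D0 & D1 & D2 & D3 & D4).
  set (L := fun x => Clog (q x / q z)).
  assert (Lz : L z = 0).
  { unfold L. replace (q z / q z) with (RtoC 1) by (field; auto). apply Clog_1. }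
  assert (CLog : forall f : C -> C, forall x, ccont f x -> (Cmod (f x - 1) <= /2)%R ->
    ccont (fun y => Clog (f y)) x).
  { intros f x Hf Hx. apply (ccont_comp f Clog); auto. apply ccont_Clog, Clog_bound; auto. }
  assert (Cq : forall x, (Cmod (x - z) < delta)%R -> ccont (fun y => q y / q z) x).
  { intros x Hx. destruct (Hl x ltac:(lra)) as [T1 T2].
    apply (ccont_mult q (fun _ => / q z)); [|apply ccont_const].
    apply const_or_germ_ccont, quotient_const_or_germ; auto. apply H4; lra. }
  assert (CL : forall x, (Cmod (x - z) < delta)%R -> ccont L x).
  { intros x Hx. apply CLog; auto. apply Rlt_le, H1. lra. }
  assert (EL : forall x, (Cmod (x - z) < delta)%R -> Cexp (L x) = q x / q z).
  { intros x Hx. apply Cexp_Clog, Clog_bound. apply Rlt_le, H1. lra. }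
  (* [exp_factor] with [s = 1] carries the leading term of [q / q z] over to its logarithm. *)
  assert (GL : exists c' : C, c' <> 0 /\ germ L z (S k) c').
  { assert (Zd : (Cmod (z - z) < delta)%R).
    { replace (z - z) with (RtoC 0) by ring. rewrite Cmod_0. auto. }
    destruct (exp_factor L (fun x => q x / q z) 1 z delta) as (u & Hu & Eu & HE); auto.
    { apply C1_nz. }
    { intros x Hx. replace (1 * L x) with (L x) by ring. auto. }
    assert (Nu : u z <> 0).
    { rewrite Eu. apply Cinv_neq_0.
      replace (1 * (q z / q z)) with (RtoC 1) by (field; auto). apply C1_nz. }
    exists (c * / q z * u z). split.
    - repeat apply Cmult_neq_0; auto. apply Cinv_neq_0; auto.
    - eapply germ_factor; [exact HE|exact Hu|].
      apply (germ_factor _ q (fun _ => / q z)); auto.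
      + exists 1%R. split. lra. intros x _. field. auto.
      + apply ccont_const. }
  destruct GL as (c' & Hc' & Hg').
  destruct (hurwitz _ _ _ _ delta Lz Hc' Hg' Hdelta) as (r & m & Hr & Hm & HH).
  set (l1 := ln (Cmod (p1 d1 z))). set (l2 := ln (Cmod (p2 d2 z))).
  assert (P1 : (0 < Cmod (p1 d1 z))%R) by (apply Cmod_gt_0; auto).
  assert (P2 : (0 < Cmod (p2 d2 z))%R) by (apply Cmod_gt_0; auto).
  assert (I1 := pos_INR d1). assert (I2 := pos_INR d2).
  assert (A1 := Rabs_pos l1). assert (A2 := Rabs_pos l2).
  (* Here 10 is 3 + 3 for the two values of [Clog] plus 4 for the argument of [cn], as [PI <= 4]. *)
  destruct (ln_lt_linear (10 + Rabs l1 + Rabs l2) (INR d1 + INR d2) m) as [N3 [HN3 HN3']];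
    try lra.
  exists (N1 + N2 + N3)%nat. intros n Hn. specialize (HN3' n ltac:(lia)).
  assert (Hn1 : (1 <= INR n)%R) by (apply (le_INR 1); lia).
  assert (NZn : forall d, RtoC (INR n ^ d) <> 0).
  { intros d E0. apply RtoC_inj in E0. revert E0. apply pow_nonzero. lra. }
  assert (NZI : RtoC (INR n) <> 0) by (intros E0; apply RtoC_inj in E0; lra).
  set (g1 := RtoC (INR n ^ d1) * p1 d1 z). set (g2 := RtoC (INR n ^ d2) * p2 d2 z).
  assert (Ng1 : g1 <> 0) by (apply Cmult_neq_0; auto).
  assert (Ng2 : g2 <> 0) by (apply Cmult_neq_0; auto).
  assert (Nqn : q z ^ n <> 0) by (apply Cpow_nz; auto).
  specialize (H2 n). specialize (H3 n).
  (* The factor of [F] independent of [x] is [1 / v]. Since [|q z| = 1], only powers of [n] enter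
     [|v|], so its logarithm [cn] is [O(log n)]. *)
  set (v := - g2 / (g1 * q z ^ n)).
  assert (Nv : v <> 0).
  { intros E0. apply Ng2. replace g2 with (- (v * (g1 * q z ^ n))) by (unfold v; field; auto).
    rewrite E0. ring. }
  destruct (Cexp_surj v Nv) as (cn & Ecn & Fcn & Scn).
  assert (Bcn : (Cmod cn <= 4 + Rabs l1 + Rabs l2 + (INR d1 + INR d2) * ln (INR n))%R).
  { assert (Hln : (0 <= ln (INR n))%R).
    { rewrite <- ln_1. apply ln_le; lra. }
    assert (Ev : fst cn = (INR d2 * ln (INR n) + l2 - (INR d1 * ln (INR n) + l1))%R).
    { rewrite Fcn. unfold v. rewrite Cmod_div, Cmod_opp, Cmod_mult, Cmod_pow, Hqm, pow1, Rmult_1_r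
        by (apply Cmult_neq_0; auto).
      unfold g1, g2. rewrite !Cmod_mult, !Cmod_R, !(Rabs_pos_eq (INR n ^ _)) by (apply pow_le; lra).
      rewrite ln_div, !ln_mult, !ln_pow by (try apply Rmult_lt_0_compat; try apply pow_lt; lra).
      reflexivity. }
    assert (P4 := PI_4).
    eapply Rle_trans. apply Cmod_le_abs.
    enough (Rabs (fst cn) <= Rabs l1 + Rabs l2 + (INR d1 + INR d2) * ln (INR n))%R by lra.
    assert (X1 := Rle_abs l1). assert (X2 := Rle_abs l2).
    assert (X3 := Rle_abs (- l1)). assert (X4 := Rle_abs (- l2)). rewrite Rabs_Ropp in X3, X4.
    assert (0 <= INR d1 * ln (INR n))%R by (apply Rmult_le_pos; auto).
    assert (0 <= INR d2 * ln (INR n))%R by (apply Rmult_le_pos; auto).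
    rewrite Ev. apply Rabs_le. lra. }
  set (E1 := fun x => coeff d1 p1 n x / g1). set (E2 := fun x => coeff d2 p2 n x / g2).
  set (Y := fun x => L x + / RtoC (INR n) * (Clog (E1 x) + (- Clog (E2 x) + - cn))).
  (* The sign is placed so that [P_n = 0] reads [A = B]. *)
  set (A := fun x => - (1) * (coeff d1 p1 n x * lambda1 x ^ n)).
  set (B := fun x => coeff d2 p2 n x * lambda2 x ^ n).
  assert (HE1 : forall x, (Cmod (x - z) < delta)%R -> (Cmod (E1 x - 1) <= /2)%R).
  { intros x Hx. apply H2. lia. lra. }
  assert (HE2 : forall x, (Cmod (x - z) < delta)%R -> (Cmod (E2 x - 1) <= /2)%R).
  { intros x Hx. apply H3. lia. lra. }
  (* [E2 x] has positive real part, so the coefficient in its numerator cannot vanish. *)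
  assert (NB : forall x, (Cmod (x - z) < delta)%R -> lambda2 x <> 0 /\ coeff d2 p2 n x <> 0).
  { intros x Hx. split. apply H4; lra. intros E0.
    destruct (Clog_bound _ (HE2 x Hx)) as [X _]. unfold E2 in X. rewrite E0 in X.
    replace (0 / g2) with (RtoC 0) in X by (field; auto). simpl in X. lra. }
  assert (NB' : forall x, (Cmod (x - z) < delta)%R -> B x <> 0).
  { intros x Hx. destruct (NB x Hx). apply Cmult_neq_0; auto. apply Cpow_nz; auto. }
  assert (EY : forall x, (Cmod (x - z) < delta)%R -> Cexp (RtoC (INR n) * Y x) = A x / B x).
  { intros x Hx. unfold Y.
    replace (RtoC (INR n) * (L x + / RtoC (INR n) * (Clog (E1 x) + (- Clog (E2 x) + - cn))))
      with (RtoC (INR n) * L x + (Clog (E1 x) + (- Clog (E2 x) + - cn))) by (field; auto).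
    destruct (NB x Hx) as [X1 X2].
    rewrite !Cexp_plus, !Cexp_opp, Cexp_mult_INR, EL, Ecn by auto.
    rewrite (Cexp_Clog (E1 x)) by (apply Clog_bound; auto).
    rewrite (Cexp_Clog (E2 x)) by (apply Clog_bound; auto).
    assert (Eq : forall y, lambda2 y <> 0 -> q y ^ n = lambda1 y ^ n / lambda2 y ^ n).
    { intros y Hy. unfold q, Cdiv. rewrite Cpow_mult_l, Cpow_inv by auto. reflexivity. }
    assert (Eqq : (q x / q z) ^ n = lambda1 x ^ n / lambda2 x ^ n / q z ^ n).
    { rewrite <- Eq by auto. unfold Cdiv. rewrite Cpow_mult_l, Cpow_inv by auto. reflexivity. }
    rewrite Eqq. unfold v, E1, E2, A, B.
    assert (X3 : lambda2 x ^ n <> 0) by (apply Cpow_nz; auto).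
    field. repeat split; auto. }
  destruct (HH Y) as [w [Hw Ew]].
  - intros x Hx. assert (Hxd : (Cmod (x - z) < delta)%R) by lra.
    destruct (Hl x ltac:(lra)) as [T1 T2].
    assert (TA : taylor_at A x).
    { apply taylor_scal, taylor_mult. apply taylor_coeff. intros; apply Hp1; auto; lra.
      apply taylor_pow; auto. }
    assert (TB : taylor_at B x).
    { apply taylor_mult. apply taylor_coeff. intros; apply Hp2; auto; lra.
      apply taylor_pow; auto. }
    assert (CE1 : ccont E1 x).
    { apply (ccont_mult _ (fun _ => / g1)); [|apply ccont_const].
      apply taylor_ccont, taylor_coeff. intros; apply Hp1; auto; lra. }
    assert (CE2 : ccont E2 x).
    { apply (ccont_mult _ (fun _ => / g2)); [|apply ccont_const].
      apply taylor_ccont, taylor_coeff. intros; apply Hp2; auto; lra. }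
    assert (CY : ccont Y x).
    { apply ccont_plus. apply CL; auto.
      apply (ccont_mult (fun _ => / RtoC (INR n))). apply ccont_const.
      apply ccont_plus. apply CLog; auto.
      apply (ccont_plus (fun x => - Clog (E2 x)) (fun _ => - cn)); [|apply ccont_const].
      assert (X := ccont_mult (fun _ => - (1)) _ x (ccont_const _ x) (CLog E2 x CE2 (HE2 x Hxd))).
      intros eps He. destruct (X eps He) as [d [Hd X']]. exists d. split; auto.
      intros y Hy. replace (- Clog (E2 y) - - Clog (E2 x))
        with (- (1) * Clog (E2 y) - - (1) * Clog (E2 x)) by ring. auto. }
    (* With [s = n], the dichotomy for the quotient [A / B] of analytic functions passes to [Y]. *)
    destruct (exp_factor Y (fun x => A x / B x) (RtoC (INR n)) x (delta - Cmod (x - z)))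
      as (u & Hu & Eu & HE); auto.
    { lra. }
    { intros y Hy. apply EY. replace (y - z) with ((y - x) + (x - z)) by ring.
      eapply Rle_lt_trans. apply Cmod_triangle. lra. }
    eapply const_or_germ_factor; [exact HE|exact Hu| |apply quotient_const_or_germ; auto].
    rewrite Eu, <- EY by auto. apply Cinv_neq_0, Cmult_neq_0; auto. apply Cexp_neq_0.
  - intros x Hx. assert (Hxd : (Cmod (x - z) < delta)%R) by lra.
    unfold Y. match goal with |- (Cmod (?a + ?b - ?a) < _)%R =>
      replace (a + b - a) with b by ring end.
    rewrite Cmod_mult, Cmod_inv, Cmod_R, Rabs_pos_eq by (auto; lra).
    destruct (Clog_bound _ (HE1 x Hxd)) as [_ X1]. destruct (Clog_bound _ (HE2 x Hxd)) as [_ X2].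
    assert (X3 : (Cmod (Clog (E1 x) + (- Clog (E2 x) + - cn)) <= 6 + Cmod cn)%R).
    { eapply Rle_trans. apply Cmod_triangle.
      assert (X4 := Cmod_triangle (- Clog (E2 x)) (- cn)). rewrite !Cmod_opp in X4. lra. }
    apply (Rmult_lt_reg_l (INR n)). lra. rewrite <- Rmult_assoc, Rinv_r, Rmult_1_l by lra. lra.
  - exists w. assert (Hwd : (Cmod (w - z) < delta)%R) by lra. split. lra.
    assert (X := EY w Hwd). rewrite Ew in X.
    replace (RtoC (INR n) * 0) with (RtoC 0) in X by ring. rewrite Cexp_0 in X.
    assert (NBw := NB' w Hwd).
    assert (X2 : A w = B w).
    { replace (A w) with (A w / B w * B w) by (field; auto). rewrite <- X. ring. }
    fold (B w). rewrite <- X2. unfold A. ring.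
Qed.

(** * Sequences of zeros and equimodular points *)

(** A diagonal choice: [s n] is a zero of [P n] meeting the best tolerance [1 / (j + 1)] attainable
    among [j <= n]. The cap [j <= n] makes the best one exist, even if zeros of [P n] accumulate at
    [z]. *)
Lemma limit_of_zeros_intro (D : C -> Prop) (P : nat -> C -> C) (z : C) :
  D z ->
  (forall eps, (0 < eps)%R -> exists N, forall n, (N <= n)%nat ->
     exists w, D w /\ (Cmod (w - z) < eps)%R /\ P n w = 0) ->
  limit_of_zeros D P z.
Proof.
  intros Hz H.
  set (good := fun n k w => D w /\ (Cmod (w - z) < / INR (S k))%R /\ P n w = 0).
  assert (Mono : forall k j, (j <= k)%nat -> (/ INR (S k) <= / INR (S j))%R).
  { intros k j Hj. apply Rinv_le_contravar. apply lt_0_INR; lia. apply le_INR; lia. }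
  assert (Hs : forall n, exists w, D w /\
     forall j, (j <= n)%nat -> (exists v, good n j v) -> good n j w).
  { intros n. generalize n at 1. intros m. induction m as [|m [w [Dw IH]]].
    - destruct (classic (exists v, good n 0%nat v)) as [[v Hv]|Hn].
      + exists v. split. apply Hv. intros j Hj _. replace j with 0%nat by lia. auto.
      (* When no tolerance is attainable, [z] is the default, so that [s n] always lies in [D]. *)
      + exists z. split; auto. intros j Hj Hv. replace j with 0%nat in Hv by lia. contradiction.
    - destruct (classic (exists v, good n (S m) v)) as [[v Hv]|Hn].
      + exists v. split. apply Hv. intros j Hj _. destruct Hv as (V1 & V2 & V3).
        repeat split; auto. eapply Rlt_le_trans; [exact V2|]. apply Mono; auto.
      + exists w. split; auto. intros j Hj Hv. apply IH; auto.
        destruct (Nat.eq_dec j (S m)) as [->|]; [contradiction|lia]. }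
  set (s := fun n => proj1_sig (constructive_indefinite_description _ (Hs n))).
  assert (Hsp : forall n, D (s n) /\
     forall j, (j <= n)%nat -> (exists v, good n j v) -> good n j (s n)).
  { intros n. unfold s. destruct constructive_indefinite_description. auto. }
  assert (Ev : forall k, exists N, forall n, (N <= n)%nat -> good n k (s n)).
  { intros k. destruct (H (/ INR (S k))%R) as [N HN].
    apply Rinv_0_lt_compat, lt_0_INR; lia.
    exists (N + k)%nat. intros n Hn. apply Hsp. lia. apply HN. lia. }
  exists s. split; [|split].
  - intros n. apply Hsp.
  - destruct (Ev 0%nat) as [N HN]. exists N. intros n Hn. apply HN. auto.
  - intros Q HQ. apply locally_Cmod in HQ. destruct HQ as [r [Hr HQ]].
    destruct (INR_unbounded (/ r)) as [k Hk].
    destruct (Ev k) as [N HN]. exists N. intros n Hn. apply HQ.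
    destruct (HN n Hn) as (_ & X & _).
    assert (P1 : (0 < / r)%R) by (apply Rinv_0_lt_compat; auto).
    assert (/ INR (S k) <= r)%R.
    { rewrite <- (Rinv_inv r). apply Rinv_le_contravar; auto. rewrite S_INR. lra. }
    lra.
Qed.

(** Were the ratio locally constant at an equimodular point, its value [omega] would be unimodular
    and [lambda1 - omega lambda2] would vanish near [w], hence on all of [D]. *)
Lemma ratio_germ (D : C -> Prop) (lambda1 lambda2 : C -> C) :
  is_domain D ->
  (forall x, D x -> taylor_at lambda1 x) -> (forall x, D x -> taylor_at lambda2 x) ->
  ~ (exists omega : C, Cmod omega = 1%R
       /\ forall x : C, D x -> lambda1 x = omega * lambda2 x) ->
  forall w, D w -> Cmod (lambda1 w) = Cmod (lambda2 w) -> lambda2 w <> 0 ->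
  exists (k : nat) (c : C), c <> 0 /\ germ (fun x => lambda1 x / lambda2 x) w (S k) c.
Proof.
  intros HD T1 T2 Hno w Dw Hb Hw.
  destruct (quotient_const_or_germ lambda1 lambda2 w) as [[d [Hd Hc]]|Hg]; auto.
  exfalso. apply Hno. exists (lambda1 w / lambda2 w).
  assert (Pw : (0 < Cmod (lambda2 w))%R) by (apply Cmod_gt_0; auto). split.
  { rewrite Cmod_div, Hb by auto. field. lra. }
  set (omega := lambda1 w / lambda2 w) in *.
  set (f := fun x => lambda1 x + (- omega) * lambda2 x).
  intros x Dx. apply NNPP. intros Hne.
  destruct (identity_theorem D f HD) with (z := w) as [e [He H]]; auto.
  { intros y Dy. apply taylor_plus; auto. apply taylor_scal; auto. }
  { exists x. split; auto. intros E. apply Hne.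
    replace (lambda1 x) with (f x + omega * lambda2 x) by (unfold f; ring). rewrite E. ring. }
  destruct (ccont_nonzero_near lambda2 w (taylor_ccont _ _ (T2 w Dw)) Hw) as [e2 [He2 H2]].
  set (t := (Rmin d (Rmin e e2) / 2)%R).
  assert (Pt : (0 < Rmin d (Rmin e e2))%R) by (repeat apply Rmin_pos; auto).
  assert (L1 := Rmin_l d (Rmin e e2)). assert (L2 := Rmin_r d (Rmin e e2)).
  assert (L3 := Rmin_l e e2). assert (L4 := Rmin_r e e2).
  set (y := w + RtoC t).
  assert (Ey : Cmod (y - w) = t).
  { unfold y. replace (w + RtoC t - w) with (RtoC t) by ring. rewrite Cmod_R, Rabs_pos_eq; auto.
    unfold t; lra. }
  apply (H y).
  - rewrite Ey. unfold t; lra.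
  - intros E. rewrite E in Ey. replace (w - w) with (RtoC 0) in Ey by ring.
    rewrite Cmod_0 in Ey. unfold t in Ey; lra.
  - assert (X := Hc y ltac:(rewrite Ey; unfold t; lra)).
    assert (X2 := H2 y ltac:(rewrite Ey; unfold t; lra)). cbv beta in X. fold omega in X.
    unfold f. replace (lambda1 y) with (lambda1 y / lambda2 y * lambda2 y) by (field; auto).
    rewrite X. ring.
Qed.

(** The point is [conj(b) / b] with [b = 1 + i t]: [1 - conj(b) / b = 2 i t / b] has modulus at most
    [2 t], and [t = eps / 3]. *)
Lemma unit_near_1 (eps : R) : (0 < eps)%R ->
  exists u : C, Cmod u = 1%R /\ u <> 1 /\ (Cmod (1 - u) < eps)%R.
Proof.
  intros He. set (t := (eps / 3)%R).
  set (b := ((1, t) : C)).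
  assert (Hb : (1 <= Cmod b)%R).
  { assert (X := abs_fst_le_Cmod b). unfold b in X at 1. simpl in X. rewrite Rabs_R1 in X. auto. }
  assert (Nb : b <> 0) by (apply Cmod_gt_0; lra).
  assert (E : 1 - Cconj b / b = RtoC (2 * t) * Ci / b).
  { replace (Cconj b) with (b - RtoC (2 * t) * Ci).
    - field. auto.
    - unfold b, Cconj, Cminus, Cplus, Copp, Cmult, Ci, RtoC; simpl. f_equal; ring. }
  exists (Cconj b / b). split; [|split].
  - rewrite Cmod_div, Cmod_conj by auto. field. lra.
  - intros E2. rewrite E2 in E. replace (1 - 1) with (RtoC 0) in E by ring.
    apply (f_equal Cmod) in E. rewrite Cmod_0, Cmod_div, Cmod_mult, Cmod_R, Cmod_Ci in E by auto.
    rewrite Rabs_pos_eq in E by (unfold t; lra).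
    assert (0 < 2 * t * 1 / Cmod b)%R by (apply Rdiv_lt_0_compat; unfold t; lra). lra.
  - rewrite E, Cmod_div, Cmod_mult, Cmod_R, Cmod_Ci, Rabs_pos_eq by (auto; unfold t; lra).
    apply Rle_lt_trans with (2 * t)%R; [|unfold t; lra].
    apply (Rmult_le_reg_r (Cmod b)). lra. unfold Rdiv. rewrite Rmult_assoc, Rinv_l by lra.
    unfold t. nra.
Qed.

(* Hurwitz' theorem, applied to [q - u q(z)] with [u <> 1] unimodular and close to 1. *)
Lemma equimodular_points (q : C -> C) (z : C) (k : nat) (c : C) (rho : R) :
  (0 < rho)%R -> (forall x, (Cmod (x - z) < rho)%R -> const_or_germ q x) ->
  q z <> 0 -> c <> 0 -> germ q z (S k) c ->
  exists w, (Cmod (w - z) < rho)%R /\ w <> z /\ Cmod (q w) = Cmod (q z).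
Proof.
  intros Hrho Hq Nq Hc Hg.
  destruct (hurwitz (fun x => q x + - q z) z k c rho) as (r & m & Hr & Hm & HH); auto.
  { ring. }
  { intros eps He. destruct (Hg eps He) as [d [Hd H]]. exists d. split; auto.
    intros x Hx. replace (q x + - q z - (q z + - q z)) with (q x - q z) by ring. auto. }
  assert (P : (0 < Cmod (q z))%R) by (apply Cmod_gt_0; auto).
  destruct (unit_near_1 (m / Cmod (q z))) as (u & Hu1 & Hu2 & Hu3).
  { apply Rdiv_lt_0_compat; auto. }
  destruct (HH (fun x => q x + - (u * q z))) as [w [Hw Ew]].
  - intros x Hx. apply (const_or_germ_factor _ q (fun _ => 1)).
    + exists 1%R. split. lra. intros y _. ring.
    + apply ccont_const.
    + apply C1_nz.
    + apply Hq. lra.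
  - intros x Hx. replace (q x + - (u * q z) - (q x + - q z)) with ((1 - u) * q z) by ring.
    rewrite Cmod_mult. apply (Rmult_lt_compat_r (Cmod (q z))) in Hu3; auto.
    unfold Rdiv in Hu3. rewrite Rmult_assoc, Rinv_l in Hu3 by lra. lra.
  - assert (E : q w = u * q z).
    { replace (q w) with (q w + - (u * q z) + u * q z) by ring. rewrite Ew. ring. }
    exists w. split. lra. split.
    + intros ->. apply Hu2. replace u with (u * q z / q z) by (field; auto). rewrite <- E.
      field. auto.
    + rewrite E, Cmod_mult, Hu1. ring.
Qed.

Theorem theorem2p1
  (D : C -> Prop) (P : nat -> C -> C)
  (lambda1 lambda2 : C -> C) (d1 d2 : nat) (p1 p2 : nat -> C -> C) :
  is_domain D ->
  (forall n : nat, (1 <= n)%nat -> analytic_on D (P n)) ->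
  analytic_on D lambda1 ->
  analytic_on D lambda2 ->
  (exists x : C, D x /\ lambda1 x <> RtoC 0) ->
  (exists x : C, D x /\ lambda2 x <> RtoC 0) ->
  ~ (exists omega : C, Cmod omega = 1%R
       /\ forall x : C, D x -> lambda1 x = (omega * lambda2 x)%C) ->
  (forall j : nat, (j <= d1)%nat -> analytic_on D (p1 j)) ->
  (forall j : nat, (j <= d2)%nat -> analytic_on D (p2 j)) ->
  (exists x : C, D x /\ p1 d1 x <> RtoC 0) ->
  (exists x : C, D x /\ p2 d2 x <> RtoC 0) ->
  (forall n : nat, (1 <= n)%nat -> forall x : C, D x ->
     P n x = (coeff d1 p1 n x * lambda1 x ^ n
              + coeff d2 p2 n x * lambda2 x ^ n)%C) ->
  forall z : C, D z ->
  ((Cmod (lambda1 z) > Cmod (lambda2 z))%R /\ p1 d1 z = RtoC 0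
   \/ (Cmod (lambda2 z) > Cmod (lambda1 z))%R /\ p2 d2 z = RtoC 0)
  \/
  (Cmod (lambda1 z) = Cmod (lambda2 z) /\ (Cmod (lambda2 z) > 0)%R
   /\ (p1 d1 z <> RtoC 0 \/ p2 d2 z <> RtoC 0)) ->
  limit_of_zeros D P z.
Proof.
  intros HD _ Al1 Al2 _ _ Hno Ap1 Ap2 N1 N2 HP z Dz Hcase.
  assert (Tl1 : forall x, D x -> taylor_at lambda1 x)
    by (intros x Dx; apply analytic_taylor; auto).
  assert (Tl2 : forall x, D x -> taylor_at lambda2 x)
    by (intros x Dx; apply analytic_taylor; auto).
  assert (Tp1 : forall x j, D x -> (j <= d1)%nat -> taylor_at (p1 j) x)
    by (intros x j Dx Hj; apply analytic_taylor, Ap1; auto).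
  assert (Tp2 : forall x j, D x -> (j <= d2)%nat -> taylor_at (p2 j) x)
    by (intros x j Dx Hj; apply analytic_taylor, Ap2; auto).
  destruct (identity_theorem D (p1 d1) HD ltac:(intros; apply Tp1; auto) N1 z Dz) as [r1 [Hr1 I1]].
  destruct (identity_theorem D (p2 d2) HD ltac:(intros; apply Tp2; auto) N2 z Dz) as [r2 [Hr2 I2]].
  destruct (proj1 (locally_Cmod z D) (proj1 (proj2 HD) z Dz)) as [r0 [Hr0 H0]].
  (* An isolated zero excludes the locally constant alternative. *)
  assert (Zero : forall (p : C -> C) r, taylor_at p z -> p z = 0 -> (0 < r)%R ->
    (forall x, (Cmod (x - z) < r)%R -> x <> z -> p x <> 0) ->
    exists (k : nat) (c : C), c <> 0 /\ germ p z (S k) c).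
  { intros p r Tp E Hr HI. destruct (taylor_const_or_germ _ _ Tp) as [[d [Hd Hc]]|Hg]; auto.
    exfalso. set (t := (Rmin d r / 2)%R).
    assert (Pt : (0 < Rmin d r)%R) by (apply Rmin_pos; auto).
    assert (L1 := Rmin_l d r). assert (L2 := Rmin_r d r).
    assert (Ey : Cmod (z + RtoC t - z) = t).
    { replace (z + RtoC t - z) with (RtoC t) by ring. rewrite Cmod_R, Rabs_pos_eq; auto.
      unfold t; lra. }
    apply (HI (z + RtoC t)).
    - rewrite Ey. unfold t; lra.
    - intros E2. rewrite E2 in Ey. replace (z - z) with (RtoC 0) in Ey by ring.
      rewrite Cmod_0 in Ey. unfold t in Ey; lra.
    - rewrite Hc; auto. rewrite Ey. unfold t; lra. }
  apply limit_of_zeros_intro; auto. intros eps He.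
  set (rho := Rmin eps r0).
  assert (Hrho : (0 < rho)%R) by (apply Rmin_pos; auto).
  assert (Rho1 : (rho <= eps)%R) by apply Rmin_l. assert (Rho2 : (rho <= r0)%R) by apply Rmin_r.
  assert (HDr : forall x, (Cmod (x - z) < rho)%R -> D x) by (intros; apply H0; lra).
  destruct Hcase as [[[Hdom Hz]|[Hdom Hz]]|(Hbal & Hpos & _)].
  - destruct (Zero (p1 d1) r1) as (k & c & Hc & Hg); auto.
    destruct (zeros_dominant lambda1 lambda2 d1 d2 p1 p2 z rho k c) as [N HN]; auto.
    (* The successor ensures [n >= 1], where the formula for [P n] holds. *)
    exists (S N). intros n Hn. destruct (HN n ltac:(lia)) as (w & Hw & Ew).
    exists w. repeat split; auto. lra. rewrite HP; auto. lia.
  - destruct (Zero (p2 d2) r2) as (k & c & Hc & Hg); auto.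
    destruct (zeros_dominant lambda2 lambda1 d2 d1 p2 p1 z rho k c) as [N HN]; auto.
    exists (S N). intros n Hn. destruct (HN n ltac:(lia)) as (w & Hw & Ew).
    exists w. repeat split; auto. lra. rewrite HP, Cplus_comm; auto. lia.
  - assert (Nl2 : lambda2 z <> 0) by (apply Cmod_gt_0; lra).
    assert (Nl1 : lambda1 z <> 0) by (apply Cmod_gt_0; lra).
    destruct (ratio_germ D lambda1 lambda2 HD Tl1 Tl2 Hno z Dz Hbal Nl2) as (k & c & Hc & Hg).
    destruct (ccont_nonzero_near lambda2 z (taylor_ccont _ _ (Tl2 z Dz)) Nl2) as [r3 [Hr3 H3]].
    set (sigma := Rmin rho (Rmin r1 (Rmin r2 r3))).
    assert (Hs : (0 < sigma)%R) by (apply Rmin_pos; [exact Hrho|repeat apply Rmin_pos; auto]).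
    assert (S1 := Rmin_l rho (Rmin r1 (Rmin r2 r3))).
    assert (S2 := Rmin_r rho (Rmin r1 (Rmin r2 r3))).
    assert (S3 := Rmin_l r1 (Rmin r2 r3)). assert (S4 := Rmin_r r1 (Rmin r2 r3)).
    assert (S5 := Rmin_l r2 r3). assert (S6 := Rmin_r r2 r3). fold sigma in S1, S2.
    (* Within [sigma] of [z] the leading coefficients can vanish only at [z], and [lambda2] not at
       all; so [w <> z] makes both leading coefficients nonzero at [w]. *)
    destruct (equimodular_points (fun x => lambda1 x / lambda2 x) z k c sigma)
      as (w & Hw & Hwz & Ew); auto.
    { intros x Hx. assert (D x) by (apply HDr; lra).
      apply quotient_const_or_germ; auto. apply H3; lra. }
    { intros E. apply Nl1. replace (lambda1 z) with (lambda1 z / lambda2 z * lambda2 z)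
        by (field; auto). rewrite E. ring. }
    assert (Dw : D w) by (apply HDr; lra).
    assert (Nw : lambda2 w <> 0) by (apply H3; lra).
    assert (Bw : Cmod (lambda1 w) = Cmod (lambda2 w)).
    { assert (Pw : (0 < Cmod (lambda2 w))%R) by (apply Cmod_gt_0; auto).
      rewrite !Cmod_div, Hbal in Ew by auto.
      replace (Cmod (lambda1 w)) with (Cmod (lambda1 w) / Cmod (lambda2 w) * Cmod (lambda2 w))%R
        by (field; lra).
      rewrite Ew. field. lra. }
    destruct (ratio_germ D lambda1 lambda2 HD Tl1 Tl2 Hno w Dw Bw Nw) as (k' & c' & Hc' & Hg').
    assert (Near : forall x, (Cmod (x - w) < rho - Cmod (w - z))%R -> (Cmod (x - z) < rho)%R).
    { intros x Hx. replace (x - z) with ((x - w) + (w - z)) by ring.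
      eapply Rle_lt_trans. apply Cmod_triangle. lra. }
    (* The point [w] is fixed once [eps] is given, so the threshold [N] may depend on it; the radius
       keeps the zeros near [w] within [rho] of [z]. *)
    destruct (zeros_balanced lambda1 lambda2 d1 d2 p1 p2 w (rho - Cmod (w - z)) k' c')
      as [N HN]; auto.
    { lra. }
    { apply I1; auto; lra. }
    { apply I2; auto; lra. }
    exists (S N). intros n Hn. destruct (HN n ltac:(lia)) as (v & Hv & Ev).
    assert (Hvz := Near v Hv).
    exists v. repeat split; auto. lra. rewrite HP; auto. lia.
Qed.
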